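(* Suppose $\kappa\ge n$ and there exists an algorithm $\mathcal{A}\in\mathcal{F}_\alpha$ (the family of distributed extended first-order algorithms defined in the context) with the following property: ''For any $\epsilon>0$ and any $N$ convex functions $\{f_i\}_{i\in[N]}$ where each $f_i$ is $L$-smooth and $f=\frac1N\sum_{i=1}^N f_i$ is $\mu$-strongly convex (with minimizer $x^*$), there exists $H_\epsilon$ such that the output $\hat x=\mathcal{A}(\{f_i\}_{i\in[N]},H_\epsilon)$ satisfies $\mathbb{E}[f(\hat x)-f(x^* )]\le\epsilon$.'' Then, when $$m\ge\max\left\{\exp\left(\frac{\alpha}{\max\{1,\alpha\}}e^{\frac{2}{\max\{1,\alpha\}}+1}\right),\ (e+\max\{1,\alpha\})^2\right\},$$ we must have $$H_\epsilon\ge\left(\frac{\sqrt{\kappa/n-1}}{4\sqrt2\,\big((e+\max\{1,\alpha\})\log m\big)^{3/2}}\right)\log\left(\left(1-\frac{1}{(e+e^\alpha)(e+\max\{1,\alpha\})^2}\right)\frac{\mu n\|w^*\|^2}{4\epsilon}\right)\ge\Omega\left(\sqrt{\frac{\kappa}{n(\log m)^3}}\,\log\left(\frac{\mu n\|w^*\|^2}{\epsilon}\right)\right),$$ where $w^*$ is the vector defined in the context.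
   Context: $[N]=\{1,\dots,N\}$; $m$ machines; $N=mn$ with positive integers $m\ll n$; $\kappa=L/\mu$; $\alpha\ge0$ is a constant; norms are Euclidean; $\log$ is the natural logarithm and $e$ its base. The functions are defined on $\mathbb{R}^d$. A function is $L$-smooth if it is differentiable with $L$-Lipschitz gradient; $f$ is $\mu$-strongly convex with $\mu>0$: $\|\nabla f(x)-\nabla f(y)\|\ge\mu\|x-y\|$ for all $x,y$. Vector $w^*$. Put $\kappa'=\kappa/n$, $k=(e+\max\{1,\alpha\})\log m$ (taken to be an integer for simplicity of notation), $b=uk$ with a sufficiently large integer $u$, and $$h=\frac{\sqrt{\kappa'+k-1}-\sqrt k}{\sqrt{\kappa'+k-1}+\sqrt k}.$$ Then $w^*=(w_1^*,\dots,w_b^* )^T\in\mathbb{R}^b$ with $w_j^*=h^j$ for $j=1,\dots,b$. Family $\mathcal{F}_\alpha$. An algorithm $\mathcal{A}$ for minimizing $f=\frac1N\sum_i f_i$ with $m$ machines is in $\mathcal{F}_\alpha$ if it distributes $\{f_i\}_{i\in[N]}$ to the machines only once at the beginning as follows: (1) $[N]$ is randomly and evenly partitioned into $S_1,\dots,S_m$ with $|S_j|=n$; (2) for each $j$ a multi-set $R_j$ of size $\alpha n$ is created by sampling (uniformly) with replacement from $[N]$; (3) with $S_j'=S_j\cup R_j$, machine $j$ acquires $\{f_i: i\in S_j'\}$; and then lets the machines operate in rounds as follows. (1) Machine $j$ maintains a local set of vectors $W_j$, initialized to $\{\mathbf 0\}$. (2) In each round, arbitrarily many times, machine $j$ can add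 to $W_j$ any $w$ satisfying $$\gamma w+\nu\nabla F_j(w)\in\mathrm{span}\Big\{w',\ \nabla F_j(w'),\ (\nabla^2F_j(w')+D)w'',\ (\nabla^2F_j(w')+D)^{-1}w''\ \Big|\ w',w''\in W_j,\ D\text{ diagonal},\ \nabla^2F_j(w')\text{ and }(\nabla^2F_j(w')+D)^{-1}\text{ exist}\Big\}$$ for some $\gamma,\nu$ such that $\gamma\nu\ne0$, where $F_j=\sum_{i\in U_j}f_i$ with an arbitrary subset $U_j\subset S_j'$. (3) At the end of the round, all machines can simultaneously send any vectors in their $W_j$ to any other machines, and machines can add the received vectors to their own sets. (4) The final output is a vector in the linear span of one $W_j$. $\mathcal{A}(\{f_i\}_{i\in[N]},H)$ denotes the output of $\mathcal{A}$ applied for $H$ rounds to $\{f_i\}_{i\in[N]}$; it may be random, due to the data distribution and to internal randomization. An ''algorithm'' is any sequence of operations obeying these rules: it need not be describable by a Turing machine and it can access any information (even the minimizer).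
   Formalization: As printed, machines could add every eigenvector of a quadratic f_i's Hessian and finish in one round, so w must be the unique solution of γw+ν∇F_j(w)=v for the chosen v in the span; the bound on H_ε is worst-case over {f_i}, u may depend on ε, and Ω is for κ/n and μn‖w*‖²/ε large. *)

(* Defs.v *)
(* MathComp-Analysis; the reals are an arbitrary R : realType. *)
From HB Require Import structures.
From mathcomp Require Export all_boot all_order all_algebra.
From mathcomp Require Export all_classical all_reals all_analysis.

Set Implicit Arguments.
Unset Strict Implicit.
Unset Printing Implicit Defensive.

Export Order.TTheory GRing.Theory Num.Theory.
Export numFieldNormedType.Exports.

Local Open Scope classical_set_scope.
Local Open Scope ring_scope.

(* The library norm `|x| on matrices is the sup norm, hence this definition. *)
Definition enorm (R : realType) (d : nat) (x : 'cV[R]_d) : R :=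
  Num.sqrt (\sum_i x i 0 ^+ 2).

Definition grad (R : realType) (d : nat) (f : 'cV[R]_d -> R) (x : 'cV[R]_d) :
    'cV[R]_d :=
  \col_i 'D_(delta_mx i 0) f x.

(* Meaningful only under has_hess f x. *)
Definition hess (R : realType) (d : nat) (f : 'cV[R]_d -> R) (x : 'cV[R]_d) :
    'M[R]_d :=
  \matrix_(i, j) 'D_(delta_mx j 0) (fun y => grad f y i 0) x.

Definition has_hess (R : realType) (d : nat) (f : 'cV[R]_d -> R)
    (x : 'cV[R]_d) : Prop :=
  differentiable (grad f) x.

Definition smooth (R : realType) (d : nat) (L : R) (f : 'cV[R]_d -> R) : Prop :=
  (forall x, differentiable f x) /\
  (forall x y, enorm (grad f x - grad f y) <= L * enorm (x - y)).

(* Only used for f convex and differentiable. *)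
Definition strongly_convex (R : realType) (d : nat) (mu : R)
    (f : 'cV[R]_d -> R) : Prop :=
  forall x y, mu * enorm (x - y) <= enorm (grad f x - grad f y).

Definition minimizer (R : realType) (d : nat) (f : 'cV[R]_d -> R)
    (x : 'cV[R]_d) : Prop :=
  forall y, f x <= f y.

Definition average (R : realType) (N d : nat) (f : 'I_N -> 'cV[R]_d -> R)
    (x : 'cV[R]_d) : R :=
  N%:R^-1 * \sum_i f i x.

Definition admissible (R : realType) (N d : nat) (L mu : R)
    (f : 'I_N -> 'cV[R]_d -> R) : Prop :=
  [/\ forall i, convex_function [set: convex_lmodType 'cV[R]_d] (f i),
      forall i, smooth L (f i)
    & strongly_convex mu (average f)].

(* Nonnegative reals that the text takes to be integers (k, and the size
   alpha n of the multi-sets R_j) are rounded up. *)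
Definition ceiln (R : realType) (x : R) : nat := `|Num.ceil x|%N.

(** The vector w^* *)

Definition kval (R : realType) (alpha : R) (m : nat) : nat :=
  ceiln ((expR 1 + Num.max 1 alpha) * ln m%:R).

Definition hval (R : realType) (alpha kappa : R) (m n : nat) : R :=
  let k : R := (kval alpha m)%:R in
  let kappa' := kappa / n%:R in
  (Num.sqrt (kappa' + k - 1) - Num.sqrt k) /
  (Num.sqrt (kappa' + k - 1) + Num.sqrt k).

Definition wstar (R : realType) (alpha kappa : R) (m n u : nat) :
    'cV[R]_(u * kval alpha m) :=
  \col_j hval alpha kappa m n ^+ j.+1.

(** Distribution of the data *)

(* The first component maps an index to the machine j whose S_j contains it;
   the second one lists, for each machine j, the r indices sampled with
   replacement that form R_j. *)
Definition allocation (m n r : nat) : finType :=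
  ({ffun 'I_(m * n) -> 'I_m} * {ffun 'I_m -> {ffun 'I_r -> 'I_(m * n)}})%type.

(* The distribution of the data is uniform on this set: a uniform ordered
   partition into parts of size n, and independent uniform samples. *)
Definition even_allocations (m n r : nat) : {set allocation m n r} :=
  [set a : allocation m n r |
    [forall j : 'I_m, #|[set i | a.1 i == j]| == n]].

(* S'_j, the set of the indices of the functions held by machine j *)
Definition acquired (m n r : nat) (a : allocation m n r) (j : 'I_m) :
    {set 'I_(m * n)} :=
  [set i | a.1 i == j] :|: [set a.2 j t | t in 'I_r].

(** Rounds *)

Definition lin_span (R : realType) (d : nat) (A : set 'cV[R]_d) :
    set 'cV[R]_d :=
  [set x | exists2 s : seq 'cV[R]_d, (forall v, v \in s -> A v)
                                   & x \in span s].

Definition local_directions (R : realType) (d : nat) (F : 'cV[R]_d -> R)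
    (W : seq 'cV[R]_d) : set 'cV[R]_d :=
  [set v |
    [\/ v \in W,
        exists2 w, w \in W & v = grad F w,
        exists w w' (D : 'M[R]_d),
          [/\ w \in W, w' \in W, is_diag_mx D, has_hess F w
            & v = (hess F w + D) *m w']
      | exists w w' (D : 'M[R]_d),
          [/\ w \in W, w' \in W, is_diag_mx D, has_hess F w
            & hess F w + D \in unitmx /\ v = invmx (hess F w + D) *m w']]].

(* The equation must determine w: w is its only solution for the given
   right-hand side.  For convex F_j this is automatic when gamma and nu have
   the same sign.  Without it, taking -gamma / nu in the spectrum of the Hessian
   of a quadratic F_j makes all the corresponding eigenvectors, in particular
   those that depend on coordinates not yet reached, available at once. *)
Definition can_add (R : realType) (N d : nat) (f : 'I_N -> 'cV[R]_d -> R)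
    (S : {set 'I_N}) (W : seq 'cV[R]_d) (w : 'cV[R]_d) : Prop :=
  exists (U : {set 'I_N}) (gamma nu : R) (v : 'cV[R]_d),
    let F := fun x => \sum_(i in U) f i x in
    [/\ U \subset S,
        gamma * nu != 0,
        lin_span (local_directions F W) v,
        gamma *: w + nu *: grad F w = v
      & forall w', gamma *: w' + nu *: grad F w' = v -> w' = w].

Inductive local_steps (R : realType) (N d : nat) (f : 'I_N -> 'cV[R]_d -> R)
    (S : {set 'I_N}) (W : seq 'cV[R]_d) : seq 'cV[R]_d -> Prop :=
| local_stop : local_steps f S W W
| local_add W' w :
    local_steps f S W W' -> can_add f S W' w -> local_steps f S W (w :: W').

Definition communicate (R : realType) (m d : nat)
    (W W' : 'I_m -> seq 'cV[R]_d) : Prop :=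
  forall j, {subset W j <= W' j} /\
            (forall w, w \in W' j -> exists j', w \in W j').

Inductive run (R : realType) (m n r d : nat)
    (f : 'I_(m * n) -> 'cV[R]_d -> R) (a : allocation m n r) :
    nat -> ('I_m -> seq 'cV[R]_d) -> Prop :=
| run_init : run f a 0 (fun=> [:: 0])
| run_round H W W' W'' :
    run f a H W ->
    (forall j, local_steps f (acquired a j) (W j) (W' j)) ->
    communicate W' W'' ->
    run f a H.+1 W''.

Definition possible_output (R : realType) (m n r d : nat)
    (f : 'I_(m * n) -> 'cV[R]_d -> R) (a : allocation m n r) (H : nat)
    (x : 'cV[R]_d) : Prop :=
  exists W j, run f a H W /\ x \in span (W j).

(* The algorithms of the family for m machines, n functions per machine and
   multi-sets of size r.  The operations may depend on the functions themselves,
   on the allocation and on a random seed independent of the allocation. *)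
Record algorithm (R : realType) (m n r : nat) := Algorithm {
  alg_disp : measure_display;
  alg_seed : measurableType alg_disp;
  alg_prob : probability alg_seed R;
  alg_output : forall d, ('I_(m * n) -> 'cV[R]_d -> R) -> nat ->
    allocation m n r -> alg_seed -> 'cV[R]_d;
  alg_measurable : forall d (f : 'I_(m * n) -> 'cV[R]_d -> R) H a i,
    measurable_fun setT (fun s => alg_output f H a s i 0 : R);
  alg_possible : forall d (f : 'I_(m * n) -> 'cV[R]_d -> R) H a s,
    a \in even_allocations m n r ->
    possible_output f a H (alg_output f H a s)
}.

Arguments alg_output {R m n r} A {d} f H a s : rename.

Definition expected_gap (R : realType) (m n r d : nat) (A : algorithm R m n r)
    (f : 'I_(m * n) -> 'cV[R]_d -> R) (H : nat) (xstar : 'cV[R]_d) : \bar R :=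
  ((#|even_allocations m n r|%:R^-1)%:E *
   \sum_(a in even_allocations m n r)
     'E_(alg_prob A)[fun s => (average f (alg_output A f H a s)
                               - average f xstar)%R])%E.

Definition reaches_every_accuracy (R : realType) (m n r : nat) (L mu : R)
    (A : algorithm R m n r) : Prop :=
  forall (eps : R) (d : nat) (f : 'I_(m * n) -> 'cV[R]_d -> R)
         (xstar : 'cV[R]_d),
    0 < eps -> admissible L mu f -> minimizer (average f) xstar ->
    exists H : nat, (expected_gap A f H xstar <= eps%:E)%E.

(* Main.v *)
(* Coordinates are grouped into n blocks of length b.  In each block a chain of
   links, cut into k classes according to the index modulo k, is distributed
   over m functions.  A machine that holds fewer than k of the m functions of a
   block lacks a whole class of links, hence in one round it cannot carry
   information along the chain by more than k coordinates: the gradient, the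
   Hessian plus a diagonal matrix, and the inverse of the latter all preserve the
   vectors supported on one side of a missing link.  A Chernoff bound shows that
   for most allocations every machine holds fewer than k functions of a given
   block, so after H rounds the coordinates of index at least kH of most blocks
   are still 0, while the minimizer has h^(j+1) there; strong convexity turns
   this into a lower bound on the expected gap. *)
Require Import Defs.
From mathcomp Require Import perm measurable_realfun ring lra zify.

Set Implicit Arguments.
Unset Strict Implicit.
Unset Printing Implicit Defensive.

Local Open Scope ring_scope.

(** * Load of the machines *)

(** The ratio kappa / n comes from the blocks: each function is strongly convex on its own block
    only, with modulus mu n, and averaging over the n blocks leaves mu, while each function may keep
    smoothness constant L. Good and bad allocations are distinguished block by block, so that
    linearity of the expectation suffices and no joint estimate over blocks is required. The chain
    is finite, hence it must be long compared to H before its unreached tail is a definite fraction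
    of the norm; this is why u depends on eps. In the final bound, 4 eps combines the mu / 2 of
    strong convexity with a factor 2 lost in the tail estimate, and sqrt 2 absorbs the rounding of
    k. *)

Section EvenPartitions.
Variables (I J : finType) (n : nat).
Hypothesis cardI : #|I| = (#|J| * n)%N.
Implicit Types (T G : {set I}) (p : {ffun I -> J}).

Definition even_partitions : {set {ffun I -> J}} :=
  [set p : {ffun I -> J} | [forall j, #|[set i | p i == j]| == n]].

Definition even_containing (j : J) T : {set {ffun I -> J}} :=
  [set p in even_partitions | T \subset [set i | p i == j]].

(** Relabelling by the transposition of x and y is injective, keeps the sizes of the parts, and
    fixes T because neither point lies in it. *)
Lemma even_containing_swap j T x y : x \notin T -> y \notin T ->
  (#|even_containing j (x |: T)| <= #|even_containing j (y |: T)|)%N.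
Proof.
move=> xT yT.
pose sw p := [ffun i => p (tperm x y i)].
have sw_inj : injective sw.
  by move=> p q /ffunP pq; apply/ffunP => i; have := pq (tperm x y i); rewrite !ffunE tpermK.
rewrite -(card_imset _ sw_inj); apply/subset_leq_card/fintype.subsetP => _ /imsetP[p + ->].
rewrite !inE !finset.subUset !finset.sub1set !inE ffunE tpermR.
move=> /and3P[/forallP ep -> /fintype.subsetP Tp] /=.
apply/andP; split; last first.
  apply/fintype.subsetP => i iT; have := Tp i iT; rewrite !inE ffunE tpermD //.
    by apply: contraNneq xT => ->.
  by apply: contraNneq yT => ->.
apply/forallP => j'; rewrite -(eqP (ep j')).
rewrite -[X in _ == X](card_imset _ (@perm_inj _ (tperm x y))); apply/eqP/eq_card => i.
by rewrite -[in RHS](tpermK x y i) (mem_imset _ _ perm_inj) !inE ffunE.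
Qed.

(** Double counting of the pairs of a partition and a point y of part j outside T. *)
Lemma even_containing_sum j T :
  (\sum_(y | y \notin T) #|even_containing j (y |: T)| =
   #|even_containing j T| * (n - #|T|))%N.
Proof.
rewrite -sum_nat_const.
under eq_bigr do rewrite -sum1_card big_mkcond /=.
rewrite exchange_big [RHS]big_mkcond /=; apply: eq_bigr => p _.
case: ifP => [|pT]; last first.
  apply: big1 => y _; case: ifP => //.
  rewrite !inE finset.subUset in pT * => /and3P[ep _ Tp].
  by rewrite ep Tp in pT.
rewrite inE => /andP[ep Tp].
have nE : #|[set i | p i == j]| = n.
  by move: ep; rewrite inE => /forallP/(_ j)/eqP.
rewrite -nE -(cardsDS Tp) -sum1_card big_mkcond [RHS]big_mkcond /=.
apply: eq_bigr => y _.
move: ep; rewrite !inE finset.subUset finset.sub1set Tp andbT !inE => ->.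
by case: (y \in T).
Qed.

(* Exchangeability reduces the count for T + x to its average over x outside T:
   given that j holds T, it also holds x with probability
   (n - #|T|) / (#|I| - #|T|) <= 1 / #|J|. *)
Lemma even_containingU1 j T x : x \notin T ->
  (#|J| * #|even_containing j (x |: T)| <= #|even_containing j T|)%N.
Proof.
move=> xT; have J_gt0 : (0 < #|J|)%N by apply/card_gt0P; exists j.
have Tlt : (#|T| < #|I|)%N.
  rewrite -cardsT; apply: proper_card.
  by apply/properP; split; [exact: finset.subsetT | exists x].
have := even_containing_sum j T.
rewrite (eq_bigr (fun=> #|even_containing j (x |: T)|)); last first.
  by move=> y yT; apply/eqP; rewrite eqn_leq !even_containing_swap.
rewrite sum_nat_const.
have -> : #|[pred i | i \notin T]| = (#|I| - #|T|)%N.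
  by rewrite -(cardC (mem T)) addKn; apply: eq_card => i.
move=> cE; rewrite -(leq_pmul2l (m := #|I| - #|T|)) ?subn_gt0//.
rewrite mulnCA cE mulnCA [leqRHS]mulnC leq_mul2l; apply/orP; right.
rewrite mulnBr -cardI; apply: leq_sub2l.
by rewrite leq_pmull.
Qed.

(* By even_containingU1, adding an element to G costs at most the factor it would
   cost if the elements were assigned independently. *)
Lemma even_containing_mgf (R : realFieldType) (b : R) j T G :
  0 <= b -> [disjoint T & G] ->
  \sum_(p in even_containing j T) (1 + b) ^+ #|[set i | p i == j] :&: G| <=
  #|even_containing j T|%:R * (1 + b / #|J|%:R) ^+ #|G|.
Proof.
move=> b0; have J_gt0 : (0 < #|J|)%N by apply/card_gt0P; exists j.
elim: {G}_.+1 {-2}G (ltnSn #|G|) T => // l IH G; rewrite ltnS => Gl T.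
have [->|[x xG]] := set_0Vmem G.
  by move=> _; under eq_bigr do rewrite finset.setI0 cards0 expr0; rewrite sumr_const cards0 expr0 mulr1.
move=> dis.
have := finset.setD1K xG; set G' := finset.setD G [set x] => GE.
have xG' : x \notin G' by rewrite !inE eqxx.
have cG : #|G| = #|G'|.+1 by rewrite -GE cardsU1 xG'.
have xT : x \notin T by rewrite (disjointFl dis).
have dis' : [disjoint T & G'].
  by apply: disjointWr dis; apply: subsetDl.
have dis'' : [disjoint x |: T & G'].
  by rewrite -setI_eq0 finset.setIUl finset.setU_eq0 !setI_eq0 dis' disjoints1 xG'.
(* Splitting off x: the extra term survives only when x is in part j, so it is a sum of the same
   kind with [x |: T] in place of T. This is why T is general in the induction. *)
have step (p : {ffun I -> J}) : (1 + b) ^+ #|[set i | p i == j] :&: G| =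
  (1 + b) ^+ #|[set i | p i == j] :&: G'| +
  (if p x == j then b * (1 + b) ^+ #|[set i | p i == j] :&: G'| else 0).
  rewrite -GE finset.setIUr; case: ifP => px.
    have -> : [set i | p i == j] :&: [set x] = [set x].
      by apply/finset.setIidPr; rewrite finset.sub1set inE.
    by rewrite cardsU1 !inE px eqxx /= exprS; ring.
  have -> : [set i | p i == j] :&: [set x] = finset.set0.
    by apply/setP => i; rewrite !inE; have [->|] := eqVneq i x; rewrite ?px ?andbF.
  by rewrite finset.set0U addr0.
under eq_bigr do rewrite step.
rewrite big_split /= -big_mkcondr /=.
have -> : \sum_(p in even_containing j T | p x == j) b * (1 + b) ^+ #|[set i | p i == j] :&: G'|
  = b * \sum_(p in even_containing j (x |: T)) (1 + b) ^+ #|[set i | p i == j] :&: G'|.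
  rewrite mulr_sumr; apply: eq_bigl => p.
  by rewrite !inE finset.subUset finset.sub1set !inE; case: (p x == j); rewrite ?andbT ?andbF.
have G'l : (#|G'| < l)%N by rewrite -cG.
have h1 := IH G' G'l T dis'.
have h2 := IH G' G'l (x |: T) dis''.
have h3 := even_containingU1 j xT.
apply: (le_trans (lerD h1 (ler_wpM2l b0 h2))).
rewrite cG exprS; set E := (_ ^+ _).
have E0 : 0 <= E by rewrite exprn_ge0 // addr_ge0 // divr_ge0.
have -> : #|even_containing j T|%:R * ((1 + b / #|J|%:R) * E) =
  #|even_containing j T|%:R * E + b / #|J|%:R * #|even_containing j T|%:R * E by ring.
rewrite lerD2l mulrA ler_wpM2r// -mulrA ler_wpM2l//.
by rewrite mulrC ler_pdivlMr ?ltr0n// -natrM mulnC ler_nat.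
Qed.

(** As G has one element per part, the bound (1 + b / #|J|) ^ #|J| is at most expR b, whatever the
    number of parts. *)
Lemma even_partitions_mgf (R : realType) (b : R) j G : 0 <= b -> #|G| = #|J| ->
  \sum_(p in even_partitions) (1 + b) ^+ #|[set i | p i == j] :&: G| <=
  #|even_partitions|%:R * expR b.
Proof.
move=> b0 GJ; have J_gt0 : (0 < #|J|)%N by apply/card_gt0P; exists j.
have E : even_containing j finset.set0 = even_partitions.
  by apply/setP => p; rewrite inE finset.sub0set andbT.
rewrite -E; apply: le_trans (even_containing_mgf _ b0 _) _.
  by rewrite -setI_eq0 finset.set0I.
rewrite ler_wpM2l// GJ.
rewrite -[leRHS](_ : expR (b / #|J|%:R) ^+ #|J| = _); last first.
  by rewrite -expRM_natl; congr expR; field; rewrite pnatr_eq0 -lt0n.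
by apply: lerXn2r; rewrite ?nnegrE ?expR_ge0 ?expR_ge1Dx // addr_ge0 // divr_ge0.
Qed.

End EvenPartitions.

(** The distinct sampled points in G are at most the draws that hit G; the draws are independent, so
    the exponential moment of their number factors. *)
Lemma sampling_mgf (R : realType) (I : finType) (r : nat) (b : R) (G : {set I}) :
  0 <= b -> (0 < #|I|)%N ->
  \sum_(rho : {ffun 'I_r -> I}) (1 + b) ^+ #|[set rho t | t in 'I_r] :&: G| <=
  #|{ffun 'I_r -> I}|%:R * expR (b * r%:R * #|G|%:R / #|I|%:R).
Proof.
move=> b0 I_gt0.
apply: (@le_trans _ _ (\sum_(rho : {ffun 'I_r -> I})
    \prod_(t < r) (if rho t \in G then 1 + b else 1))).
  apply: ler_sum => rho _; rewrite -big_mkcond /= prodr_const.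
  apply: ler_weXn2l; first by rewrite lerDl.
  have -> : [set rho t | t in 'I_r] :&: G = [set rho t | t in [pred t | rho t \in G]].
    apply/setP => x; rewrite inE; apply/andP/imsetP => [[/imsetP[t _ ->] xG]|[t tG ->]].
      by exists t.
    by split => //; apply/imsetP; exists t.
  exact: leq_imset_card.
rewrite -(bigA_distr_bigA (fun _ : 'I_r => fun x => if x \in G then 1 + b else 1)) /=.
rewrite prodr_const card_ord card_ffun card_ord natrX.
have -> : \sum_x (if x \in G then 1 + b else 1) = #|I|%:R * (1 + b * #|G|%:R / #|I|%:R).
  rewrite (eq_bigr (fun x => 1 + if x \in G then b else 0)); last first.
    by move=> x _; case: ifP; rewrite ?addr0.
  rewrite big_split /= -big_mkcond /= !sumr_const.
  rewrite -[b *+ _]mulr_natr; field; by rewrite pnatr_eq0 -lt0n.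
rewrite exprMn ler_wpM2l ?exprn_ge0//.
rewrite -[leRHS](_ : expR (b * #|G|%:R / #|I|%:R) ^+ r = _); last first.
  by rewrite -expRM_natl; congr expR; field; rewrite pnatr_eq0 -lt0n.
by apply: lerXn2r; rewrite ?nnegrE ?expR_ge0 ?expR_ge1Dx // addr_ge0 // divr_ge0 // mulr_ge0.
Qed.

(** * Chernoff bound for the number of functions of one block held by a machine *)

Section Load.
Variables (R : realType) (m n r : nat).
Hypothesis n_gt0 : (0 < n)%N.
Implicit Types (G : {set 'I_(m * n)}).

Let cardI : #|'I_(m * n)| = (#|'I_m| * n)%N.
Proof. by rewrite !card_ord. Qed.

Lemma even_allocationsE :
  even_allocations m n r = finset.setX (even_partitions 'I_(m * n) 'I_m n)
    [set: {ffun 'I_m -> {ffun 'I_r -> 'I_(m * n)}}]%SET.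
Proof.
apply/setP => -[p q]; rewrite !inE andbT; apply: eq_forallb => j; congr (_ == _).
by apply: eq_card => i; rewrite inE; apply/idP/idP; rewrite in_setE.
Qed.

Lemma load_mgf (j : 'I_m) G (b : R) : 0 <= b -> #|G| = m ->
  \sum_(a in even_allocations m n r) (1 + b) ^+ #|acquired a j :&: G| <=
  #|even_allocations m n r|%:R * expR (b * (1 + r%:R / n%:R)).
Proof.
move=> b0 Gm; have m_gt0 : (0 < m)%N by apply: leq_ltn_trans (ltn_ord j).
(* The trivial factors for the other machines put the summand in product form, so that the sum over
   all samples factors over the machines. *)
apply: (@le_trans _ _ (\sum_(a in even_allocations m n r)
   (1 + b) ^+ #|[set i | a.1 i == j] :&: G| *
   \prod_(j' < m) (if j' == j then (1 + b) ^+ #|[set a.2 j' t | t in 'I_r] :&: G| else 1))).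
  apply: ler_sum => a _; rewrite (bigD1 j)//= eqxx big1 ?mulr1; last first.
    by move=> j' /negPf ->.
  rewrite -exprD; apply: ler_weXn2l; first by rewrite lerDl.
  by rewrite /acquired finset.setIUl leq_card_setU.
rewrite even_allocationsE cardsX cardsT natrM.
rewrite (eq_bigl (fun a => (a.1 \in even_partitions 'I_(m * n) 'I_m n) && true)); last first.
  by move=> [p q]; rewrite !inE.
rewrite -(pair_big (mem (even_partitions 'I_(m * n) 'I_m n)) predT
  (fun (p : {ffun 'I_(m * n) -> 'I_m}) (q : {ffun 'I_m -> {ffun 'I_r -> 'I_(m * n)}}) =>
   (1 + b) ^+ #|[set i | p i == j] :&: G| *
   \prod_(j' < m) (if j' == j then (1 + b) ^+ #|[set q j' t | t in 'I_r] :&: G| else 1))) /=.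
under eq_bigr do rewrite -mulr_sumr.
rewrite -mulr_suml mulrDr mulr1 expRD [leRHS]mulrACA.
apply: ler_pM.
- by apply: sumr_ge0 => p _; rewrite exprn_ge0 // addr_ge0.
- by apply: sumr_ge0 => q _; apply: prodr_ge0 => j' _; case: ifP => _ //; rewrite exprn_ge0 // addr_ge0.
- by apply: even_partitions_mgf => //; rewrite card_ord.
rewrite -(bigA_distr_bigA (fun (j' : 'I_m) (q : {ffun 'I_r -> 'I_(m * n)}) =>
  if j' == j then (1 + b) ^+ #|[set q t | t in 'I_r] :&: G| else 1)) /=.
rewrite (bigD1 j)//= eqxx.
rewrite [X in _ * X <= _](eq_bigr (fun=> #|{ffun 'I_r -> 'I_(m * n)}|%:R)); last first.
  by move=> j' /negPf ->; rewrite sumr_const.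
rewrite prodr_const cardC1 card_ord.
have -> : #|{ffun 'I_m -> {ffun 'I_r -> 'I_(m * n)}}| =
    (#|{ffun 'I_r -> 'I_(m * n)}| * #|{ffun 'I_r -> 'I_(m * n)}| ^ m.-1)%N.
  by rewrite -expnS prednK // card_ffun; congr (_ ^ _)%N; exact: card_ord.
rewrite natrM natrX [leRHS]mulrAC ler_wpM2r ?exprn_ge0//.
apply: le_trans (sampling_mgf _ _ b0 _) _; first by rewrite card_ord muln_gt0 m_gt0.
rewrite ler_wpM2l// ler_expR Gm card_ord natrM.
by rewrite le_eqVlt; apply/orP; left; apply/eqP; field; rewrite !pnatr_eq0 -!lt0n m_gt0 n_gt0.
Qed.

(** Exponential Markov inequality and a union bound over the machines: with 1 + b = e, an overloaded
    machine makes expR (load - k) at least 1. *)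
Lemma overload_card (k : nat) G : #|G| = m ->
  #|[set a in even_allocations m n r | [exists j, (k <= #|acquired a j :&: G|)%N]]|%:R <=
  m%:R * expR ((expR 1 - 1) * (1 + r%:R / n%:R) - k%:R) * #|even_allocations m n r|%:R :> R.
Proof.
move=> Gm; set b : R := expR 1 - 1.
have b0 : 0 <= b by rewrite subr_ge0 (le_trans _ (expR_ge1Dx _)) ?lerDl.
apply: (@le_trans _ _ (\sum_(a in even_allocations m n r) \sum_(j < m)
    expR (- k%:R) * (1 + b) ^+ #|acquired a j :&: G|)).
  rewrite -sum1_card natr_sum big_mkcond [leRHS]big_mkcond /=.
  apply: ler_sum => a _; rewrite finset.in_set; case: (a \in _) => //=.
  have ge0 j : 0 <= expR (- k%:R) * (1 + b) ^+ #|acquired a j :&: G|.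
    by rewrite mulr_ge0 ?expR_ge0 ?exprn_ge0 // addr_ge0.
  case: ifPn => [/existsP[j kj]|_]; last exact: sumr_ge0.
  rewrite (bigD1 j)//= -[leLHS]addr0 lerD ?sumr_ge0//.
  rewrite /b addrC subrK -expRM_natl mulr1 -expRD -[leLHS]expR0 ler_expR.
  by rewrite addrC subr_ge0 ler_nat.
rewrite exchange_big /=.
apply: (@le_trans _ _ (\sum_(j < m) expR (- k%:R) *
    (#|even_allocations m n r|%:R * expR (b * (1 + r%:R / n%:R))))).
  by apply: ler_sum => j _; rewrite -mulr_sumr ler_wpM2l ?expR_ge0 ?load_mgf.
rewrite sumr_const card_ord -mulr_natl expRD le_eqVlt; apply/orP; left.
by apply/eqP; ring.
Qed.

End Load.

(** * Quadratic functions *)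

Local Open Scope classical_set_scope.
Local Open Scope ring_scope.

Section Quadratic.
Context {R : realType} {d : nat}.
Implicit Types (A B : 'M[R]_d) (c u v w x y : 'cV[R]_d).

Definition dot u v : R := \sum_i u i 0 * v i 0.

Lemma dotC u v : dot u v = dot v u.
Proof. by apply: eq_bigr => i _; rewrite mulrC. Qed.

Lemma dotDr u v w : dot u (v + w) = dot u v + dot u w.
Proof. by rewrite -big_split; apply: eq_bigr => i _; rewrite mxE mulrDr. Qed.

Lemma dotZr (a : R) u v : dot u (a *: v) = a * dot u v.
Proof. by rewrite mulr_sumr; apply: eq_bigr => i _; rewrite mxE mulrCA. Qed.

Lemma dotNr u v : dot u (- v) = - dot u v.
Proof. by rewrite -scaleN1r dotZr mulN1r. Qed.

Lemma dotDl u v w : dot (v + w) u = dot v u + dot w u.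
Proof. by rewrite !(dotC _ u) dotDr. Qed.

Lemma dotZl (a : R) u v : dot (a *: v) u = a * dot v u.
Proof. by rewrite !(dotC _ u) dotZr. Qed.

Lemma dotNl u v : dot (- v) u = - dot v u.
Proof. by rewrite !(dotC _ u) dotNr. Qed.

Lemma dot_suml (I : Type) (r : seq I) (P : pred I) (F : I -> 'cV[R]_d) u :
  dot (\sum_(i <- r | P i) F i) u = \sum_(i <- r | P i) dot (F i) u.
Proof.
rewrite /dot exchange_big; apply: eq_bigr => j _ /=.
by rewrite summxE mulr_suml.
Qed.

Lemma dot_sumr (I : Type) (r : seq I) (P : pred I) (F : I -> 'cV[R]_d) u :
  dot u (\sum_(i <- r | P i) F i) = \sum_(i <- r | P i) dot u (F i).
Proof. by rewrite dotC dot_suml; apply: eq_bigr => i _; rewrite dotC. Qed.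

Lemma dot_ge0 u : 0 <= dot u u.
Proof. by apply: sumr_ge0 => i _; rewrite -expr2 sqr_ge0. Qed.

Lemma enorm_dot u : enorm u = Num.sqrt (dot u u).
Proof. by congr Num.sqrt; apply: eq_bigr => i _; rewrite expr2. Qed.

Lemma enormK u : enorm u ^+ 2 = dot u u.
Proof. by rewrite enorm_dot sqr_sqrtr ?dot_ge0. Qed.

Lemma dot_delta u i : dot (delta_mx i 0) u = u i 0.
Proof.
rewrite /dot (bigD1 i)//= big1 ?addr0 => [|j ji]; rewrite mxE ?eqxx ?mul1r//.
by rewrite (negPf ji) mul0r.
Qed.

Lemma dot_mulmx A u v : dot u (A *m v) = dot (A^T *m u) v.
Proof.
rewrite /dot; under eq_bigr do rewrite mxE mulr_sumr.
rewrite exchange_big; apply: eq_bigr => j _; rewrite mxE mulr_suml.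
by apply: eq_bigr => i _; rewrite mxE mulrCA mulrA.
Qed.

Definition quad A c x : R := 2^-1 * dot x (A *m x) - dot c x.

Lemma quadD A c x v : A^T = A ->
  quad A c (x + v) = quad A c x + dot v (A *m x - c) + 2^-1 * dot v (A *m v).
Proof.
move=> As; rewrite /quad mulmxDr !dotDl !dotDr dotNr (dotC c v).
have -> : dot x (A *m v) = dot v (A *m x) by rewrite dot_mulmx As dotC.
by field.
Qed.

(** The difference quotient is exactly b + h g. This serves the gradient, with g from the quadratic
    term, and the Hessian, with g = 0. *)
Lemma derive_second_order (f : 'cV[R]_d -> R) x v (b g : R) :
  (forall h, f (h *: v + x) = f x + h * b + h ^+ 2 * g) -> 'D_v f x = b.
Proof.
move=> fE; rewrite /derive; apply: cvg_lim => //.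
have lim_b : (fun h : R => b + h * g) @ (0:R)^' --> b.
  rewrite -[X in _ --> X]addr0 -[X in _ + X](mul0r g).
  apply: cvgD; first exact: cvg_cst.
  apply: cvgM; last exact: cvg_cst.
  exact: nbhs_dnbhs.
apply: cvg_trans lim_b; apply: near_eq_cvg; near=> h.
have h0 : h != 0 by near: h; exact: nbhs_dnbhs_neq.
by rewrite /= fE /GRing.scale/=; field.
Unshelve. all: by end_near. Qed.

Lemma differentiable_dot c x : differentiable (dot c) x.
Proof.
have -> : dot c = \sum_i (fun y => c i 0 * y i 0).
  by apply/funext => y; rewrite /dot fct_sumE.
apply: differentiable_sum => i; apply: differentiableM => //.
exact: differentiable_coord.
Qed.

Lemma differentiable_quad A c x : differentiable (quad A c) x.
Proof.
rewrite /quad; apply: differentiableB; last exact: differentiable_dot.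
apply: differentiableM => //.
have -> : (fun y => dot y (A *m y)) = \sum_i (fun y => y i 0 * dot (row i A)^T y).
  apply/funext => y; rewrite /dot fct_sumE; apply: eq_bigr => i _.
  by rewrite mxE; congr (_ * _); apply: eq_bigr => j _; rewrite !mxE.
apply: differentiable_sum => i; apply: differentiableM.
  exact: differentiable_coord.
exact: differentiable_dot.
Qed.

Lemma grad_quad A c x : A^T = A -> grad (quad A c) x = A *m x - c.
Proof.
move=> As; apply/colP => i; rewrite mxE.
rewrite (@derive_second_order _ _ _ ((A *m x - c) i 0)
   (2^-1 * dot (delta_mx i 0) (A *m delta_mx i 0))) // => h.
rewrite addrC quadD // -scalemxAr !dotZl dotZr !dot_delta; ring.
Qed.

Lemma hess_quad A c x : A^T = A -> hess (quad A c) x = A.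
Proof.
move=> As; apply/matrixP => i j; rewrite mxE.
rewrite (@derive_second_order _ _ _ (A i j) 0) // => h.
rewrite !grad_quad // !mxE mulr0 addr0.
under eq_bigr do rewrite !mxE mulrDr.
rewrite big_split /= (bigD1 j)//= eqxx mulr1 big1 ?addr0; last first.
  by move=> l /negPf lj; rewrite lj /= !mulr0.
by ring.
Qed.

Lemma convex_quad A c : A^T = A -> (forall x, 0 <= dot x (A *m x)) ->
  convex_function [set: convex_lmodType 'cV[R]_d] (quad A c).
Proof.
move=> As A0 t x y _ _.
rewrite /conv /= /conv/=.
set s : R := t%:num.
have s01 : 0 <= s <= 1 by rewrite /s; apply/andP.
have -> : s *: (x : 'cV[R]_d) + unstable.onem s *: y = x + (1 - s) *: (y - x).
  by apply/colP => i; rewrite !mxE /unstable.onem; ring.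
have -> : (y : 'cV[R]_d) = x + (y - x) by rewrite addrC subrK.
rewrite [x + (y - x) - x]addrAC subrr add0r !quadD// -scalemxAr !dotZl dotZr /unstable.onem.
have := A0 (y - x); set D := dot _ (A *m (y - x)) => D0.
rewrite /GRing.scale /= -subr_ge0.
have s1 : 0 <= s * (1 - s) by case/andP: s01 => s0 s1; rewrite mulr_ge0 ?subr_ge0.
rewrite [leRHS](_ : _ = 2^-1 * (D * (s * (1 - s)))); last by field.
by apply: mulr_ge0; [rewrite invr_ge0 | exact: mulr_ge0].
Qed.

Lemma sum_quad (I : finType) (U : {pred I}) (A : I -> 'M[R]_d) (c : I -> 'cV[R]_d) x :
  \sum_(i in U) quad (A i) (c i) x =
  quad (\sum_(i in U) A i) (\sum_(i in U) c i) x.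
Proof.
by rewrite sumrB -mulr_sumr /quad mulmx_suml dot_sumr dot_suml.
Qed.

Lemma quad_scale (a : R) A c x : a * quad A c x = quad (a *: A) (a *: c) x.
Proof. by rewrite /quad -scalemxAl dotZr dotZl; ring. Qed.

(* Schur test: Cauchy-Schwarz with the weights `|A i j|. *)
Lemma enorm_mulmx_le A (L : R) x : 0 <= L -> A^T = A ->
  (forall i, \sum_j `|A i j| <= L) -> enorm (A *m x) <= L * enorm x.
Proof.
move=> L0 As AL.
have Asym i j : A i j = A j i by rewrite -{1}As mxE.
rewrite -[L]ger0_norm// -sqrtr_sqr /enorm -sqrtrM ?sqr_ge0// ler_wsqrtr//.
have row_le i : (A *m x) i 0 ^+ 2 <= L * \sum_j `|A i j| * x j 0 ^+ 2.
  rewrite mxE.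
  have CS : (\sum_j A i j * x j 0) ^+ 2 <=
      (\sum_j `|A i j|) * \sum_j `|A i j| * x j 0 ^+ 2.
    rewrite expr2 !big_distrlr /=.
    (* Doubling and symmetrising the right side reduces the inequality to 2 |x_j| |x_l| <= x_j^2 +
       x_l^2, term by term. *)
    rewrite -(ler_pM2l (ltr0n R 2)) mulr_natl mulr2n [leRHS]mulr_natl mulr2n.
    rewrite [in X in _ <= _ + X]exchange_big /= -!big_split /=; apply: ler_sum => j _.
    rewrite -!big_split /=; apply: ler_sum => l _.
    have -> : A i j * x j 0 * (A i l * x l 0) = (A i j * A i l) * (x j 0 * x l 0) by ring.
    have : (A i j * A i l) * (x j 0 * x l 0) <= `|A i j| * `|A i l| * (`|x j 0| * `|x l 0|).
      by rewrite -!normrM; apply: ler_norm.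
    have := sqr_ge0 (`|x j 0| - `|x l 0|).
    rewrite -(real_normK (num_real (x j 0))) -(real_normK (num_real (x l 0))).
    move: (A i j * A i l * _) => q0 ab qle.
    have := mulr_ge0 (mulr_ge0 (normr_ge0 (A i j)) (normr_ge0 (A i l))) ab.
    nra.
  apply: (le_trans CS); apply: ler_wpM2r => //.
  by apply: sumr_ge0 => j _; rewrite mulr_ge0 ?sqr_ge0.
apply: (@le_trans _ _ (\sum_i L * \sum_j `|A i j| * x j 0 ^+ 2)).
  exact: ler_sum.
rewrite -mulr_sumr expr2 -mulrA ler_wpM2l// exchange_big /= mulr_sumr.
apply: ler_sum => j _; rewrite -mulr_suml ler_wpM2r ?sqr_ge0//.
by under eq_bigr do rewrite Asym.
Qed.

Lemma smooth_quad A c (L : R) : 0 <= L -> A^T = A ->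
  (forall i, \sum_j `|A i j| <= L) -> smooth L (quad A c).
Proof.
move=> L0 As AL; split=> [x|x y]; first exact: differentiable_quad.
by rewrite !grad_quad // opprB addrA subrK -mulmxBr enorm_mulmx_le.
Qed.

(** Expanding |A z - mu z|^2 >= 0 gives |A z|^2 >= 2 mu <z, A z> - mu^2 |z|^2 >= mu^2 |z|^2. *)
Lemma strongly_convex_quad A c (mu : R) : 0 <= mu -> A^T = A ->
  (forall x, mu * dot x x <= dot x (A *m x)) -> strongly_convex mu (quad A c).
Proof.
move=> mu0 As Amu x y.
rewrite !grad_quad // opprB addrA subrK -mulmxBr; move: (x - y) => z.
rewrite -[mu in leLHS]ger0_norm// -sqrtr_sqr !enorm_dot -sqrtrM ?sqr_ge0// ler_wsqrtr//.
have := dot_ge0 (A *m z - mu *: z); have := Amu z.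
rewrite !(dotDl, dotDr, dotNl, dotNr, dotZl, dotZr). rewrite (dotC _ z).
have := dot_ge0 z.
move: (dot _ _) (dot z (A *m z)) (dot (A *m z) _) => p q r p0 pq.
rewrite expr2; nra.
Qed.

Lemma quad_gap A c x xs : A^T = A -> A *m xs = c ->
  quad A c x - quad A c xs = 2^-1 * dot (x - xs) (A *m (x - xs)).
Proof.
move=> As Axs; have {1}-> : x = xs + (x - xs) by rewrite addrC subrK.
rewrite quadD // Axs subrr -[X in dot _ X](scale0r (x - xs)) dotZr mul0r addr0.
by rewrite addrAC subrr add0r.
Qed.

End Quadratic.

(** * Propagation of supports *)

Section Propagation.
Context {R : realType} {d : nat}.
Implicit Types (P A D : 'M[R]_d) (x : 'cV[R]_d) (s : seq 'cV[R]_d).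

Lemma span_fixed P s x : (forall v, v \in s -> P *m v = v) ->
  x \in span s -> P *m x = x.
Proof.
move=> sP xs; rewrite (coord_span (X := in_tuple s) xs) mulmx_sumr.
apply: eq_bigr => i _; rewrite -scalemxAr sP //.
by apply: mem_nth; rewrite /= ltn_ord.
Qed.

Lemma invmx_fixed P A x : A *m P = P *m A -> P *m x = x ->
  P *m (invmx A *m x) = invmx A *m x.
Proof.
move=> AP Px; have [uA|nA] := boolP (A \in unitmx); last first.
  (* On a singular matrix [invmx] is the identity, and A itself commutes with P. *)
  by rewrite /invmx (negPf nA) mulmxA -AP -mulmxA Px.
apply: (can_inj (mulKmx uA)).
by rewrite mulKVmx // mulmxA AP -mulmxA mulKVmx.
Qed.

Lemma diag_commute P D : is_diag_mx P -> is_diag_mx D -> D *m P = P *m D.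
Proof.
by move=> /diag_mxP[p ->] /diag_mxP[q ->]; rewrite diag_mxC.
Qed.

(** The conditions on [A i] and [c i] are additive, so they pass to the sum over any subset U; [P]
    is diagonal in order to commute with the arbitrary diagonal D. *)
Lemma local_steps_fixed N (A : 'I_N -> 'M[R]_d) (c : 'I_N -> 'cV[R]_d)
    (S : {set 'I_N}) P s s' :
  (forall i, (A i)^T = A i) -> is_diag_mx P ->
  (forall i, i \in S -> A i *m P = P *m A i) ->
  (forall i, i \in S -> P *m c i = c i) ->
  (forall v, v \in s -> P *m v = v) ->
  local_steps (fun i => quad (A i) (c i)) S s s' ->
  forall v, v \in s' -> P *m v = v.
Proof.
move=> As dP AP cP sP; elim=> // W w _ IH [U [gamma [nu [v /=]]]].
have -> : (fun x => \sum_(i in U) quad (A i) (c i) x) =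
    quad (\sum_(i in U) A i) (\sum_(i in U) c i).
  by apply/funext => x; rewrite sum_quad.
set B := \sum_(i in U) A i; set e := \sum_(i in U) c i.
case=> US _ [vs vsW vspan] wv w_unique.
have Bs : B^T = B by rewrite /B raddf_sum; apply: eq_bigr => i _; rewrite /= As.
have BP : B *m P = P *m B.
  by rewrite mulmx_suml mulmx_sumr; apply: eq_bigr => i /(fintype.subsetP US) /AP.
have eP : P *m e = e.
  by rewrite mulmx_sumr; apply: eq_bigr => i /(fintype.subsetP US) /cP.
have Pv : P *m v = v.
  apply: span_fixed vspan => y /vsW [/IH//|[w1 /IH Pw1 ->]|
    [w1 [w2 [D [_ /IH Pw2 dD _ ->]]]]|[w1 [w2 [D [_ /IH Pw2 dD _ [_ ->]]]]]].
  - by rewrite grad_quad // mulmxBr mulmxA -BP -mulmxA Pw1 eP.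
  - by rewrite hess_quad // mulmxA mulmxDr -BP -(diag_commute dP dD) -mulmxDl -mulmxA Pw2.
  - rewrite hess_quad // invmx_fixed //.
    by rewrite mulmxDl mulmxDr BP (diag_commute dP dD).
move=> y; rewrite inE => /predU1P[->|/IH//].
(* P *m w solves the same equation as w. *)
apply: w_unique; rewrite grad_quad //.
rewrite -[RHS]Pv -wv grad_quad // mulmxDr -!scalemxAr mulmxBr eP.
by rewrite mulmxA BP -mulmxA.
Qed.

End Propagation.

Section RunSupport.
Context {R : realType} {m n r d : nat}.
Variables (A : 'I_(m * n) -> 'M[R]_d) (c : 'I_(m * n) -> 'cV[R]_d).
Variables (a : allocation m n r) (pos : 'I_d -> nat) (k : nat).

Definition trunc (t : nat) : 'M[R]_d := diag_mx (\row_i (pos i < t)%N%:R).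

Lemma trunc_mulE t (x : 'cV[R]_d) i :
  (trunc t *m x) i 0 = if (pos i < t)%N then x i 0 else 0.
Proof. by rewrite mul_diag_mx !mxE; case: ifP; rewrite ?mul1r ?mul0r. Qed.

Lemma trunc_fixedP t (x : 'cV[R]_d) :
  trunc t *m x = x <-> forall i, (t <= pos i)%N -> x i 0 = 0.
Proof.
split=> [<- i ti|x0]; first by rewrite trunc_mulE ltnNge ti.
by apply/colP => i; rewrite trunc_mulE ltnNge; case: leqP => // /x0 ->.
Qed.

Lemma trunc_commute t (B : 'M[R]_d) :
  (forall i j, (pos i < t)%N != (pos j < t)%N -> B i j = 0) ->
  B *m trunc t = trunc t *m B.
Proof.
move=> B0; apply/matrixP => i j.
rewrite mul_mx_diag mul_diag_mx !mxE.
have [->|/B0 ->] := eqVneq (pos i < t)%N (pos j < t)%N; first by rewrite mulrC.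
by rewrite mul0r mulr0.
Qed.

(* If every machine lacks the functions that connect the coordinates on the two
   sides of some cut t of each window of length k, then one round of
   communication is needed for each window. *)
Lemma run_supported (H : nat) W :
  (forall i, (A i)^T = A i) ->
  (forall j s, exists t, [/\ (s < t <= s + k)%N,
     forall i, i \in acquired a j -> A i *m trunc t = trunc t *m A i &
     forall i, i \in acquired a j -> trunc t *m c i = c i]) ->
  run (fun i => quad (A i) (c i)) a H W ->
  forall j w i, w \in W j -> (H * k <= pos i)%N -> w i 0 = 0.
Proof.
move=> As cut; elim=> [|{}H {}W W' W'' _ IH steps comm] j w i.
  by rewrite inE => /eqP -> _; rewrite mxE.
move=> /((comm j).2 _) [j' wj'] Hki.
have [t [/andP[st tk] At ct]] := cut j' (H * k)%N.
have /trunc_fixedP -> // : trunc t *m w = w.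
  apply: (local_steps_fixed As _ At ct _ (steps j')) wj' => [|v vW].
    exact/diag_mx_is_diag.
  by apply/trunc_fixedP => l tl; apply: (IH j') => //; exact: leq_trans (ltnW st) tl.
by apply: leq_trans tk _; rewrite -mulSnr.
Qed.

Lemma output_supported (H : nat) x :
  (forall i, (A i)^T = A i) ->
  (forall j s, exists t, [/\ (s < t <= s + k)%N,
     forall i, i \in acquired a j -> A i *m trunc t = trunc t *m A i &
     forall i, i \in acquired a j -> trunc t *m c i = c i]) ->
  possible_output (fun i => quad (A i) (c i)) a H x ->
  forall i, (H * k <= pos i)%N -> x i 0 = 0.
Proof.
move=> As cut [W [j [rW xW]]]; apply/trunc_fixedP.
apply: span_fixed xW => v vW; apply/trunc_fixedP => i.
exact: run_supported As cut rW j v i vW.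
Qed.

End RunSupport.

(** * Convergence rate *)

Section Reals.
Context {R : realType}.
Implicit Types (x y h : R).

Lemma expR_ge_quadratic y : 0 <= y -> 1 + y + y ^+ 2 / 2 <= expR y.
Proof.
move=> y0; rewrite [leLHS](_ : _ = series (exp_coeff y) 3); last first.
  rewrite /series /= !big_nat_recr // big_nil /exp_coeff /= !factS fact0 expr0.
  by field.
apply: nondecreasing_cvgn_le; last exact: is_cvg_series_exp_coeff.
apply: nondecreasing_series => i _ _.
by rewrite /exp_coeff /= divr_ge0 // exprn_ge0.
Qed.

Lemma expR1_ge : 5 / 2 <= expR 1 :> R.
Proof. by apply: le_trans (expR_ge_quadratic _) => //; lra. Qed.

(* With y = - ln h / 2 this is 2 y <= expR y - expR (- y). *)
Lemma neg_ln_le h : 0 < h -> h < 1 -> - ln h <= (1 - h) / Num.sqrt h.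
Proof.
move=> h0 h1.
pose y := - ln h / 2.
have y0 : 0 <= y by rewrite /y divr_ge0 // oppr_ge0 ln_le0 // ltW.
have hE : expR (- y) ^+ 2 = h.
  rewrite -expRM_natl (_ : 2 * - y = ln h); last by rewrite /y; field.
  by rewrite lnK.
have -> : Num.sqrt h = expR (- y) by rewrite -hE sqrtr_sqr ger0_norm // expR_ge0.
have -> : - ln h = 2 * y by rewrite /y; field.
rewrite -{1}hE expRN.
have := expR_ge_quadratic y0.
have : 0 < expR y by exact: expR_gt0.
move: (expR y) => p p0 pq.
have -> : (1 - p^-1 ^+ 2) / p^-1 = (p ^+ 2 - 1) / p by field; rewrite gt_eqF.
rewrite ler_pdivlMr // -subr_ge0.
have q1 : 0 <= 1 + y + y ^+ 2 / 2 - y by nra.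
(* The product is (p - y)^2 - (1 + y^2 / 2)^2, while the goal amounts to (p - y)^2 >= 1 + y^2. *)
have : 0 <= (p - (1 + y + y ^+ 2 / 2)) * (p + (1 + y + y ^+ 2 / 2) - 2 * y).
  by apply: mulr_ge0; [rewrite subr_ge0|nra].
have := sqr_ge0 (y ^+ 2).
nra.
Qed.

Section Rate.
Variables (kp : R) (k : nat).
Hypotheses (kp1 : 1 <= kp) (k_gt0 : (0 < k)%N).

Definition rate : R := (Num.sqrt (kp + k%:R - 1) - Num.sqrt k%:R) /
  (Num.sqrt (kp + k%:R - 1) + Num.sqrt k%:R).

Let S := Num.sqrt (kp + k%:R - 1).
Let s := Num.sqrt (k%:R : R).
Let s0 : 0 < s. Proof. by rewrite sqrtr_gt0 ltr0n. Qed.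
Let S0 : s <= S. Proof. by rewrite ler_wsqrtr // -subr_ge0; move: kp1; lra. Qed.
Let ss : s ^+ 2 = k%:R. Proof. by rewrite sqr_sqrtr. Qed.
Let SS : S ^+ 2 = kp + k%:R - 1.
Proof. by rewrite sqr_sqrtr //; have := ler0n R k; move: kp1; lra. Qed.
Let Ss : S + s != 0. Proof. by rewrite gt_eqF // ltr_wpDl // (le_trans _ S0) // ltW. Qed.

Lemma rate_ge0 : 0 <= rate.
Proof. by rewrite divr_ge0 ?subr_ge0 ?addr_ge0 ?sqrtr_ge0. Qed.

Lemma rate_lt1 : rate < 1.
Proof.
rewrite ltr_pdivrMr ?mul1r; last by rewrite ltr_wpDl ?sqrtr_ge0.
by have := s0; rewrite -/S -/s; lra.
Qed.

(** The characteristic equation of the three-term recurrence that a minimizer satisfies inside a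
    chain. *)
Lemma rate_quadratic : (1 - rate) ^+ 2 * (kp - 1) = 4 * k%:R * rate.
Proof.
have -> : kp - 1 = S ^+ 2 - s ^+ 2 by rewrite SS ss; ring.
by rewrite -ss /rate -/S -/s; field.
Qed.

(** Logarithms give ln x <= 2 k H (- ln h), and - ln h <= (1 - h) / sqrt h. For kp > 1, sqrt (kp -
    1) (1 - h) / sqrt h is exactly 2 sqrt k; for kp = 1 the left side is 0. *)
Lemma rate_communication_bound x (H : nat) : 0 <= x ->
  x * rate ^+ (2 * (k * H)) <= 1 ->
  Num.sqrt (kp - 1) * ln x <= 4 * (k%:R * s) * H%:R.
Proof.
move=> x0 xH.
have rhs0 : 0 <= 4 * (k%:R * s) * H%:R by rewrite !mulr_ge0 // ltW.
have [x1|x1] := leP x 1.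
  by apply: le_trans rhs0; rewrite mulr_ge0_le0 ?sqrtr_ge0 ?ln_le0.
move: kp1; rewrite le_eqVlt => /predU1P[<-|kp_gt1].
  by rewrite subrr sqrtr0 mul0r.
have SsE : S ^+ 2 - s ^+ 2 = kp - 1 by rewrite SS ss; ring.
have h0 : 0 < rate.
  rewrite lt_neqAle rate_ge0 andbT eq_sym; apply/eqP => r0.
  have := rate_quadratic; rewrite r0 subr0 expr1n mul1r mulr0 => /eqP.
  by rewrite subr_eq0 gt_eqF.
have xgt0 : 0 < x by exact: lt_trans x1.
have lnx : ln x <= 2 * (k%:R * H%:R) * - ln rate.
  rewrite mulrN lerNr -subr_le0 opprK; move: xH.
  rewrite -ler_ln ?posrE ?mulr_gt0 ?exprn_gt0 // ln1 lnM ?posrE ?exprn_gt0 //.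
  by rewrite lnXn // -[_ *+ (2 * (k * H))]mulr_natl !natrM addrC.
have key : Num.sqrt (kp - 1) * ((1 - rate) / Num.sqrt rate) = 2 * s.
  have rE : rate = (kp - 1) / (S + s) ^+ 2.
    by rewrite -SsE /rate -/S -/s; field.
  have q0 : Num.sqrt (kp - 1) != 0 by rewrite gt_eqF // sqrtr_gt0 subr_gt0.
  have -> : Num.sqrt rate = Num.sqrt (kp - 1) / (S + s).
    rewrite rE sqrtrM ?subr_ge0 // -exprVn sqrtr_sqr ger0_norm // invr_ge0.
    by rewrite addr_ge0 // sqrtr_ge0.
  by rewrite /rate -/S -/s; field; rewrite Ss.
apply: (@le_trans _ _ (Num.sqrt (kp - 1) * (2 * (k%:R * H%:R) * ((1 - rate) / Num.sqrt rate)))).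
  rewrite ler_wpM2l ?sqrtr_ge0 // (le_trans lnx) // ler_wpM2l ?mulr_ge0 //.
  by rewrite neg_ln_le // rate_lt1.
by rewrite mulrCA key le_eqVlt; apply/orP; left; apply/eqP; ring.
Qed.

End Rate.

Lemma geometric_half h : 0 <= h -> h < 1 -> exists j : nat, h ^+ j <= 2^-1.
Proof.
move=> h0 h1.
have : h ^+ n @[n --> \oo] --> (0 : R) by apply: cvg_expr; rewrite ger0_norm.
move=> /cvgr_le/(_ 2^-1); rewrite invr_gt0 ltr0n => /(_ isT) [j _ hj].
by exists j; apply: hj => /=.
Qed.

End Reals.

(** * Size of the parameters *)

Section Constants.
Context {R : realType}.

Lemma ceiln_ge (x : R) : 0 <= x -> x <= (ceiln x)%:R.
Proof.
move=> x0; rewrite /ceiln natr_absz ger0_norm ?ceil_ge //.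
by rewrite ceil_ge0 (lt_le_trans _ x0) // ltrN10.
Qed.

Lemma ceiln_lt (x : R) : 0 <= x -> (ceiln x)%:R < x + 1.
Proof.
move=> x0; rewrite /ceiln natr_absz ger0_norm; last first.
  by rewrite ceil_ge0 (lt_le_trans _ x0) // ltrN10.
by have := ceilB1_lt x; rewrite intrB ltrBlDr.
Qed.

Lemma ceiln_le_nat (x : R) (n : nat) : 0 <= x -> x <= n%:R -> (ceiln x <= n)%N.
Proof.
move=> x0 xn; rewrite -ltnS -(ltr_nat R) (lt_le_trans (ceiln_lt x0)) //.
by rewrite -natr1 lerD2r.
Qed.

Variables (alpha : R) (m n : nat).
Let e : R := expR 1.
Let M : R := Num.max 1 alpha.
Let l : R := ln m%:R.
Hypotheses (alpha_ge0 : 0 <= alpha) (m_gt0 : (0 < m)%N) (mn : (m < n)%N).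
Hypothesis m_large :
  Num.max (expR (alpha / M * expR (2 / M + 1))) ((e + M) ^+ 2) <= m%:R.

Let e_ge : 5 / 2 <= e. Proof. exact: expR1_ge. Qed.
Let M_ge1 : 1 <= M. Proof. by rewrite /M le_max lexx. Qed.
Let mE : m%:R = expR l. Proof. by rewrite lnK // posrE ltr0n. Qed.

Let le_l : alpha / M * expR (2 / M + 1) <= l.
Proof. by rewrite -ler_expR -mE (le_trans _ m_large) // le_max lexx. Qed.

Let eM_le : (e + M) ^+ 2 <= m%:R.
Proof. by rewrite (le_trans _ m_large) // le_max lexx orbT. Qed.

Let eM_half : e + M <= expR (l / 2).
Proof.
rewrite -ler_sqr ?nnegrE ?expR_ge0 //; last by move: e_ge M_ge1; lra.
by rewrite -expRM_natl (_ : 2 * (l / 2) = l) -?mE //; field.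
Qed.

Let l_ge2 : 2 <= l.
Proof.
rewrite -ler_expR -mE (le_trans _ eM_le) // -[2]mulr1 expRM_natl -/e.
by rewrite ler_sqr ?nnegrE //; move: e_ge M_ge1; lra.
Qed.

Lemma kval_real_ge : 6 <= (e + M) * l.
Proof. move: e_ge M_ge1 l_ge2; nra. Qed.

Lemma kval_ge : (e + M) * l <= (kval alpha m)%:R.
Proof. by apply: ceiln_ge; apply: le_trans kval_real_ge. Qed.

Lemma kval_gt1 : (1 < kval alpha m)%N.
Proof.
by rewrite -(ltr_nat R) (lt_le_trans _ kval_ge) // (lt_le_trans _ kval_real_ge) // ltr_nat.
Qed.

(** Both e + M and ln m are at most sqrt m, the former by hypothesis. The bound ensures that no
    class of functions is empty. *)
Lemma kval_le : (kval alpha m <= m)%N.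
Proof.
apply: ceiln_le_nat; first by apply: le_trans kval_real_ge.
rewrite [leRHS](_ : _ = expR (l / 2) * expR (l / 2)); last first.
  by rewrite mE -expRD; congr expR; field.
rewrite -/e -/M -/l; apply: ler_pM; [move: e_ge M_ge1; lra | by apply: le_trans l_ge2 | exact: eM_half |].
have l0 : 0 <= l / 2 by move: l_ge2; lra.
apply: le_trans (expR_ge_quadratic l0).
have := sqr_ge0 (l / 2 - 1); nra.
Qed.

(** Rounding adds at most 1 to a number that is at least 6, and (7/6)^3 < 2. The square root of this
    2 is the sqrt 2 of the final bound. *)
Lemma kval_cube_le : (kval alpha m)%:R ^+ 3 <= 2 * ((e + M) * l) ^+ 3.
Proof.
have h6 := kval_real_ge; have h0 := le_trans (ler0n R 6) h6.
have /ltW := ceiln_lt h0; rewrite -/e -/M -/l -/(kval alpha m).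
have : 0 <= (kval alpha m)%:R :> R by [].
move: ((e + M) * l) ((kval alpha m)%:R) h6 {h0} => x y x6 y0 yx.
have : y ^+ 3 <= (x + 1) ^+ 3 by rewrite lerXn2r ?nnegrE //; lra.
move=> /le_trans; apply; rewrite -subr_ge0.
have : 0 <= (x - 6) * x ^+ 2 by rewrite mulr_ge0 ?subr_ge0 ?sqr_ge0.
have : 0 <= (x - 6) * x by rewrite mulr_ge0 ?subr_ge0 //; lra.
rewrite !exprS expr0; nra.
Qed.

(** In the exponent the factor m costs l and the denominator at most 3 l / 2 + alpha, since (e +
    M)^2 <= m and e + expR alpha <= (e + 1) expR alpha <= sqrt m expR alpha. What remains to be
    shown is [core]. *)
Lemma overload_prob_le :
  m%:R * expR ((e - 1) * (1 + (ceiln (alpha * n%:R))%:R / n%:R) - (kval alpha m)%:R)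
  <= 1 / ((e + expR alpha) * (e + M) ^+ 2).
Proof.
(* Since (7/2)^2 > 12, rounding up the size of the multi-sets changes r / n by at most 1/12. *)
have n12 : 12 <= n%:R :> R.
  apply: (@le_trans _ _ m%:R); last by rewrite ler_nat ltnW.
  by apply: le_trans eM_le; move: e_ge M_ge1; nra.
have n0 : 0 < n%:R :> R by apply: lt_le_trans n12.
have r_le : (ceiln (alpha * n%:R))%:R / n%:R <= alpha + 1 / 12 :> R.
  rewrite ler_pdivrMr // mulrDl.
  have /ltW/le_trans := ceiln_lt (mulr_ge0 alpha_ge0 (ltW n0)); apply.
  by rewrite lerD2l; lra.
have ea : e + expR alpha <= (e + 1) * expR alpha.
  have := expR_ge1Dx alpha; move: (expR alpha) => p; move: alpha_ge0 e_ge; nra.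
have core : (e - 1) * (1 + (alpha + 1 / 12)) + alpha <= (e + M - 5 / 2) * l.
  have [a1|a1] := leP alpha 1.
    have M1 : M = 1 by rewrite /M; apply/max_idPl.
    have lel := le_l; rewrite M1 in lel *.
    have l15 : alpha * (125 / 8) <= l.
      apply: le_trans lel; rewrite !divr1 ler_wpM2l //.
      rewrite (_ : 2 + 1 = 3%:R * 1); last by ring.
      rewrite expRM_natl -/e !exprS expr0 mulr1.
      have : 5 / 2 * (5 / 2) <= e * e by move: e_ge; nra.
      by move: e_ge; nra.
    (* A convex combination of the two lower bounds on l, with weights tuned to e = 5/2: there it
       gives 1.66 + 2.65 alpha, against the required 1.625 + 2.5 alpha. *)
    have : 2 * (83/100) + alpha * (125 / 8) * (17/100) <= l by move: l_ge2 l15; lra.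
    move: e_ge alpha_ge0; nra.
  have Ma : M = alpha by rewrite /M; apply/max_idPr/ltW.
  have lel := le_l; rewrite Ma in lel *.
  have a0 : 0 < alpha by lra.
  (* The hypothesis on m now reads e expR (2 / alpha) <= l, and expR (2 / alpha) >= 1 + 2 /
     alpha. *)
  have la : e * (alpha + 2) <= alpha * l.
    apply: (@le_trans _ _ (alpha * (e * (2 / alpha + 1)))).
      by rewrite le_eqVlt; apply/orP; left; apply/eqP; field; rewrite gt_eqF.
    rewrite ler_wpM2l // (le_trans _ lel) // divff ?gt_eqF // mul1r expRD -/e mulrC.
    by rewrite ler_wpM2r ?(le_trans _ e_ge) // addrC expR_ge1Dx.
  have l0 := l_ge2.
  have : 0 <= (e - 5 / 2) * l by move: e_ge; nra.
  move: e_ge; nra.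
have pos : 0 < (e + expR alpha) * (e + M) ^+ 2.
  rewrite mulr_gt0 ?exprn_gt0 // ?addr_gt0 ?expR_gt0 //.
  by rewrite (lt_le_trans _ M_ge1).
rewrite ler_pdivlMr //.
have -> : m%:R * expR ((e - 1) * (1 + (ceiln (alpha * n%:R))%:R / n%:R) - (kval alpha m)%:R)
  = expR (l + ((e - 1) * (1 + (ceiln (alpha * n%:R))%:R / n%:R) - (kval alpha m)%:R)).
  by rewrite expRD -mE.
have le2 : (e + expR alpha) * (e + M) ^+ 2 <= expR (l / 2 + alpha + l).
  rewrite !expRD -mE; apply: ler_pM => //.
  - by rewrite addr_ge0 // expR_ge0.
  - exact: sqr_ge0.
  - apply: (le_trans ea); rewrite ler_wpM2r ?expR_ge0 //.
    by apply: le_trans eM_half; rewrite lerD2l.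
apply: (@le_trans _ _ (expR (l + ((e - 1) * (1 + (ceiln (alpha * n%:R))%:R / n%:R)
  - (kval alpha m)%:R)) * expR (l / 2 + alpha + l))).
  by rewrite ler_wpM2l ?expR_ge0.
rewrite -expRD -[leRHS]expR0 ler_expR.
have kl := kval_ge.
have : (e - 1) * (1 + (ceiln (alpha * n%:R))%:R / n%:R) <= (e - 1) * (1 + (alpha + 1 / 12)).
  by rewrite ler_wpM2l ?lerD2l //; move: e_ge; lra.
move: core kl; lra.
Qed.

End Constants.

(** * The hard instance *)

Lemma sum_indicator_le1 (R : realFieldType) (N y : nat) (f : 'I_N -> nat) :
  injective f -> \sum_(j < N) (f j == y)%:R <= 1 :> R.
Proof.
move=> f_inj; rewrite -natr_sum -[leRHS]/(1%:R) ler_nat.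
rewrite (eq_bigr (fun j => if f j == y then 1%N else 0%N)) => [|j _]; last by case: eqP.
rewrite -big_mkcond sum1_card; apply/card_le1_eqP => j j'.
by rewrite !unfold_in => /eqP fj /eqP fj'; apply: f_inj; rewrite fj fj'.
Qed.

Lemma crossing_link (e t x y : nat) :
  (x.+1 == e) || (x == e) -> (y.+1 == e) || (y == e) ->
  (x < t)%N != (y < t)%N -> e = t.
Proof. by move=> /orP[]/eqP ? /orP[]/eqP ?; case: ltnP; case: ltnP => //; lia. Qed.

Section HardInstance.
Context {R : realType}.
Variables (m n k b : nat) (L mu : R).
Variable dec : 'I_(m * n) -> 'I_m * 'I_n.
Hypothesis dec_bij : bijective dec.
Hypotheses (m_gt0 : (0 < m)%N) (n_gt0 : (0 < n)%N) (k_gt1 : (1 < k)%N).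
Hypotheses (k_le_m : (k <= m)%N) (b_gt0 : (0 < b)%N) (mu_gt0 : 0 < mu).
Hypothesis kappa_ge : 1 <= L / mu / n%:R.

Let k_gt0 : (0 < k)%N. Proof. exact: ltnW. Qed.

Let h := rate (L / mu / n%:R) k.
Let h_ge0 : 0 <= h. Proof. exact: rate_ge0. Qed.
Let h_lt1 : h < 1. Proof. exact: rate_lt1. Qed.

Notation dim := #|{: 'I_n * 'I_b}|.
Definition block (i : 'I_dim) : 'I_n := (enum_val i).1.
Definition position (i : 'I_dim) : nat := (enum_val i).2.

Lemma position_lt i : (position i < b)%N.
Proof. exact: ltn_ord. Qed.

Lemma sum_coordinates (F : 'I_n -> nat -> R) :
  \sum_(i < dim) F (block i) (position i) = \sum_(g < n) \sum_(j < b) F g j.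
Proof.
rewrite pair_big /= [RHS](reindex_onto (@enum_val _ predT) enum_rank) => [|p _] /=.
  by apply: eq_bigl => i; rewrite enum_valK eqxx.
exact: enum_rankK.
Qed.

Lemma sum_functions (V : nmodType) (F : 'I_m -> 'I_n -> V) :
  \sum_(i < m * n) F (dec i).1 (dec i).2 = \sum_(g < n) \sum_(q < m) F q g.
Proof. by rewrite exchange_big pair_big /= [RHS](reindex dec) //=; exact: onW_bij. Qed.

(* The chain of b coordinates of a block is held together by b + 1 squares:
   those of x_0, of the differences x_(e-1) - x_e, and of sqrt (1 - h) x_(b-1);
   the last factor makes (h ^ (j + 1))_j an exact minimizer. *)
Definition link (e i : nat) : R :=
  (if e == b then Num.sqrt (1 - h) else 1) * (i.+1 == e)%:R - (i == e)%:R.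

Definition link_vec (g : 'I_n) (e : nat) : 'cV[R]_dim :=
  \col_i (if block i == g then link e (position i) else 0).

Definition class_card (s : nat) : nat := #|[set q : 'I_m | (q %% k == s)%N]%SET|.

(* k need not divide m, so the classes have different sizes; the weights make all
   the classes contribute equally to the average.  They are at most twice the
   mean one, which the condition of L-smoothness leaves room for. *)
Definition weight (s : nat) : R :=
  m%:R / (k%:R * (class_card s)%:R) * ((L - mu * n%:R) / 4).

Definition block_proj (g : 'I_n) : 'M[R]_dim := diag_mx (\row_i (block i == g)%:R).

(** Function q of block g carries the links whose index is congruent to q modulo k. *)
Definition hard_mx (q : 'I_m) (g : 'I_n) : 'M[R]_dim :=
  (mu * n%:R) *: block_proj g + weight (q %% k) *:
  \sum_(e < b.+1 | (e %% k == q %% k)%N) link_vec g e *m (link_vec g e)^T.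

(** [link_vec g 0] is minus the first basis vector of the block, so the linear term pulls on the
    first coordinate only. *)
Definition hard_vec (q : 'I_m) (g : 'I_n) : 'cV[R]_dim :=
  (if (q %% k == 0)%N then - weight 0 else 0) *: link_vec g 0.

Definition hard_fun (i : 'I_(m * n)) : 'cV[R]_dim -> R :=
  quad (hard_mx (dec i).1 (dec i).2) (hard_vec (dec i).1 (dec i).2).

Definition hard_min : 'cV[R]_dim := \col_i h ^+ (position i).+1.

(** Each class has at least floor (m / k) >= 1 elements, the t k + s, and m < (floor (m / k) + 1)
    k. *)
Lemma class_card_ge (s : nat) : (s < k)%N -> (m <= 2 * k * class_card s)%N.
Proof.
move=> sk; have mk1 : (0 < m %/ k)%N by rewrite divn_gt0.
suff c_ge : (m %/ k <= class_card s)%N.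
  have := ltn_ceil m k_gt0; have : (k <= m %/ k * k)%N by rewrite leq_pmull.
  move: (leq_mul (leqnn k) c_ge); lia.
have qlt (t : 'I_(m %/ k)) : (t * k + s < m)%N.
  apply: (@leq_trans (t.+1 * k)); first by rewrite mulSn addnC ltn_add2r.
  by apply: leq_trans (leq_divM m k); rewrite leq_mul2r ltn_ord orbT.
pose q t := Ordinal (qlt t).
have q_inj : injective q.
  move=> t t' /(congr1 val) /= /eqP; rewrite eqn_add2r eqn_mul2r gtn_eqF //=.
  by move=> /eqP /val_inj.
rewrite -[X in (X <= _)%N]card_ord -(card_imset _ q_inj) /class_card.
apply/subset_leq_card/fintype.subsetP => _ /imsetP[t _ ->].
by rewrite !inE /= modnMDl modn_small.
Qed.

Lemma class_card_gt0 s : (s < k)%N -> (0 < class_card s)%N.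
Proof.
by move=> /class_card_ge; case: (class_card s) => //; rewrite muln0 leqNgt m_gt0.
Qed.

Let nR : 0 < n%:R :> R. Proof. by rewrite ltr0n. Qed.

Let mun : mu * n%:R <= L.
Proof. by move: kappa_ge; rewrite ler_pdivlMr // mul1r ler_pdivlMr // mulrC. Qed.

Lemma weight_ge0 s : 0 <= weight s.
Proof.
by rewrite mulr_ge0 ?divr_ge0 ?mulr_ge0 ?subr_ge0.
Qed.

Lemma weight_le s : (s < k)%N -> 2 * weight s <= L - mu * n%:R.
Proof.
move=> sk.
have -> : 2 * weight s = m%:R / (2 * k * class_card s)%:R * (L - mu * n%:R).
  by rewrite /weight !natrM; field; rewrite !pnatr_eq0 -!lt0n k_gt0 class_card_gt0.
rewrite -[leRHS]mul1r ler_wpM2r ?subr_ge0 // ler_pdivrMr; last first.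
  by rewrite ltr0n !muln_gt0 k_gt0 class_card_gt0.
by rewrite mul1r ler_nat class_card_ge.
Qed.

Lemma class_weight s : (s < k)%N ->
  \sum_(q < m | (q %% k == s)%N) weight (q %% k) =
  m%:R * ((L - mu * n%:R) / (4 * k%:R)).
Proof.
move=> sk; rewrite (eq_bigr (fun=> weight s)) => [|q /eqP ->//].
rewrite sumr_const -[in LHS](_ : class_card s = #|_|); last first.
  by apply: eq_card => q; rewrite inE.
rewrite -mulr_natl /weight; field.
by rewrite !pnatr_eq0 -!lt0n k_gt0 class_card_gt0.
Qed.

Lemma trmx_hard_mx q g : (hard_mx q g)^T = hard_mx q g.
Proof.
rewrite /hard_mx linearD !linearZ /= tr_diag_mx; congr (_ + _ *: _).
by rewrite raddf_sum; apply: eq_bigr => e _; rewrite /= trmx_mul trmxK.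
Qed.

Lemma hard_mxM q g x : hard_mx q g *m x =
  (mu * n%:R) *: (block_proj g *m x) + weight (q %% k) *:
  \sum_(e < b.+1 | (e %% k == q %% k)%N) dot (link_vec g e) x *: link_vec g e.
Proof.
rewrite mulmxDl -!scalemxAl mulmx_suml; congr (_ + _ *: _).
apply: eq_bigr => e _; apply/colP => i.
rewrite -mulmxA !mxE big_ord1 mulrC; congr (_ * _); last by rewrite mxE.
by rewrite mxE; apply: eq_bigr => j _; rewrite mxE.
Qed.

Lemma hard_mxE q g i j : hard_mx q g i j =
  mu * n%:R * ((i == j) && (block i == g))%:R + weight (q %% k) *
  \sum_(e < b.+1 | (e %% k == q %% k)%N) link_vec g e i 0 * link_vec g e j 0.
Proof.
rewrite !mxE; congr (_ * _ + _ * _).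
  by have [->|] := eqVneq i j; rewrite ?mulr1n ?mulr0n.
by rewrite summxE; apply: eq_bigr => e _; rewrite mxE big_ord1 [(_^T) _ _]mxE.
Qed.

Lemma hard_psd q g x : 0 <= dot x (hard_mx q g *m x).
Proof.
rewrite hard_mxM dotDr !dotZr dot_sumr addr_ge0 // mulr_ge0 ?weight_ge0 //.
- by rewrite mulr_ge0 // ltW.
- apply: sumr_ge0 => i _; rewrite mul_diag_mx !mxE.
  by rewrite mulrCA mulr_ge0 // -expr2 sqr_ge0.
by apply: sumr_ge0 => e _; rewrite dotZr dotC -expr2 sqr_ge0.
Qed.

Lemma link_le e i : `|link e i| <= (i.+1 == e)%:R + (i == e)%:R.
Proof.
apply: le_trans (ler_normB _ _) _; apply: lerD; last by rewrite ger0_norm.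
rewrite normrM [X in _ * X]ger0_norm // ler_piMl //.
case: ifP => _; last by rewrite normr1.
rewrite ger0_norm ?sqrtr_ge0 // -sqrtr1 ler_wsqrtr // sqrtr1.
by rewrite lerBlDr lerDl.
Qed.

Lemma link_neq0 (e i : nat) : link e i != 0 -> (i.+1 == e) || (i == e).
Proof.
move=> nz; apply: contraNT nz; rewrite negb_or => /andP[/negPf h1 /negPf h2].
by rewrite /link h1 h2 mulr0 subr0.
Qed.

Lemma sum_link_vec g e : \sum_i `|link_vec g e i 0| <= 2.
Proof.
under eq_bigr do rewrite mxE.
rewrite (sum_coordinates (fun g' j => `|if g' == g then link e j else 0|)).
rewrite (bigD1 g) //= eqxx [X in _ + X]big1 => [|g' /negPf ->]; last first.
  by apply: big1 => j _; rewrite normr0.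
rewrite addr0.
apply: (@le_trans _ _ (\sum_(j < b) ((j.+1 == e)%:R + (val j == e)%:R))).
  by apply: ler_sum => j _; exact: link_le.
rewrite big_split /=.
have := @sum_indicator_le1 R b e (fun j => j.+1).
have := @sum_indicator_le1 R b e (fun j => j).
move=> /(_ val_inj) h1 /(_ (fun j j' jj' => val_inj (succn_inj jj'))) h2.
by rewrite -[2]/(1 + 1); exact: lerD.
Qed.

(** Position i is touched by links i and i + 1 only, which lie in different classes because k >
    1. *)
Lemma sum_link (s i : nat) : \sum_(e < b.+1 | (e %% k == s)%N) `|link e i| <= 1.
Proof.
have hit (y : nat) : \sum_(e < b.+1 | (e %% k == s)%N) (y == e :> nat)%:R <= (y %% k == s)%N%:R :> R.
  have [ys|ys] := boolP (y %% k == s)%N; last first.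
    rewrite big1 // => e; have [<-|//] := eqVneq y e.
    by rewrite (negPf ys).
  apply: le_trans (@sum_indicator_le1 _ b.+1 y val val_inj).
  rewrite big_mkcond /=; apply: ler_sum => e _.
  by rewrite [_ == y]eq_sym; case: ifP.
apply: (@le_trans _ _ (\sum_(e < b.+1 | (e %% k == s)%N)
    ((i.+1 == e)%:R + (i == e)%:R))).
  by apply: ler_sum => e _; exact: link_le.
rewrite big_split /= (le_trans (lerD (hit i.+1) (hit i))) //.
have ne : (i.+1 %% k != i %% k)%N.
  by rewrite eqn_mod_dvd // subSnn dvdn1 gtn_eqF.
rewrite -natrD -[1]/(1%:R) ler_nat; case: eqP => [E|_].
  by move: ne; rewrite E eq_sym => /negPf ->.
by rewrite add0n leq_b1.
Qed.

(** The diagonal gives mu n. The links of one class have disjoint supports, so they add at most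
    twice the weight, hence at most L - mu n. *)
Lemma hard_row_sum q g i : \sum_j `|hard_mx q g i j| <= L.
Proof.
have mun0 : 0 <= mu * n%:R by rewrite mulr_ge0 // ltW.
apply: (@le_trans _ _ (\sum_j (mu * n%:R * (i == j)%:R + weight (q %% k) *
  \sum_(e < b.+1 | (e %% k == q %% k)%N) `|link_vec g e i 0| * `|link_vec g e j 0|))).
  apply: ler_sum => j _; rewrite hard_mxE (le_trans (ler_normD _ _)) // lerD //.
    by rewrite ger0_norm ?(mulr_ge0 mun0) // ler_wpM2l // ler_nat; case: (i == j) => //=; case: (_ == _).
  rewrite normrM ger0_norm ?weight_ge0 // ler_wpM2l ?weight_ge0 //.
  rewrite (le_trans (ler_norm_sum _ _ _)) //; apply: ler_sum => e _.
  by rewrite normrM.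
rewrite big_split /= -!mulr_sumr.
have -> : \sum_j (i == j)%:R = 1 :> R.
  by rewrite (bigD1 i) //= eqxx big1 ?addr0 // => j; rewrite eq_sym => /negPf ->.
rewrite mulr1 -lerBrDl; apply: le_trans (weight_le (ltn_pmod q k_gt0)).
rewrite mulrC ler_wpM2r ?weight_ge0 // exchange_big /=.
apply: (@le_trans _ _ (\sum_(e < b.+1 | (e %% k == q %% k)%N) `|link e (position i)| * 2)).
  apply: ler_sum => e _; rewrite -mulr_sumr ler_pM ?sumr_ge0 ?sum_link_vec //.
  by rewrite mxE; case: ifP => _ //; rewrite normr0.
by rewrite -mulr_suml -[leRHS]mul1r ler_wpM2r // sum_link.
Qed.

(** * The averaged objective and its minimizer *)

Definition total_mx : 'M[R]_dim := \sum_(i < m * n) hard_mx (dec i).1 (dec i).2.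
Definition total_vec : 'cV[R]_dim := \sum_(i < m * n) hard_vec (dec i).1 (dec i).2.

Let a : R := (L - mu * n%:R) / (4 * k%:R).

Lemma sum_block_proj (x : 'cV[R]_dim) : \sum_(g < n) block_proj g *m x = x.
Proof.
apply/colP => i; rewrite summxE (bigD1 (block i)) //= big1 => [|g gi].
  by rewrite addr0 mul_diag_mx !mxE eqxx mul1r.
by rewrite mul_diag_mx !mxE eq_sym (negPf gi) mul0r.
Qed.

Lemma sum_classes (V : lmodType R) (F : nat -> V) :
  \sum_(q < m) weight (q %% k) *:
     \sum_(e < b.+1 | (e %% k == q %% k)%N) F e =
  (m%:R * a) *: \sum_(e < b.+1) F e.
Proof.
under eq_bigr do rewrite scaler_sumr big_mkcond /=.
rewrite exchange_big scaler_sumr /=; apply: eq_bigr => e _.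
rewrite -big_mkcond -scaler_suml /=; congr (_ *: _).
rewrite /a -(class_weight (ltn_pmod e k_gt0)).
by apply: eq_bigl => q; rewrite eq_sym.
Qed.

Lemma total_mxM x : total_mx *m x = m%:R *:
  ((mu * n%:R) *: x +
   a *: \sum_(g < n) \sum_(e < b.+1) dot (link_vec g e) x *: link_vec g e).
Proof.
rewrite /total_mx mulmx_suml (sum_functions (fun q g => hard_mx q g *m x)).
under eq_bigr => g _.
  under eq_bigr do rewrite hard_mxM.
  rewrite big_split /= sumr_const card_ord -scaler_nat.
  rewrite (sum_classes (fun e => dot (link_vec g e) x *: link_vec g e)).
  over.
rewrite big_split /= -!scaler_sumr sum_block_proj scalerDr !scalerA.
by [].
Qed.

Lemma total_vecE : total_vec = (m%:R * - a) *: \sum_(g < n) link_vec g 0.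
Proof.
rewrite /total_vec (sum_functions hard_vec) scaler_sumr; apply: eq_bigr => g _.
rewrite -scaler_suml; congr (_ *: _); rewrite mulrN /a -(class_weight k_gt0).
rewrite big_mkcond [in RHS]big_mkcond /= -sumrN; apply: eq_bigr => q _.
by case: ifP => [/eqP ->|]; rewrite ?oppr0.
Qed.

Lemma dot_link_min g (e : nat) : (e <= b)%N ->
  dot (link_vec g e) hard_min =
  (if e == b then Num.sqrt (1 - h) else 1) * (if e == 0%N then 0 else h ^+ e)
  - (if e == b then 0 else h ^+ e.+1).
Proof.
move=> eb; rewrite /dot.
rewrite (eq_bigr (fun i => (fun g' j => if g' == g then link e j * h ^+ j.+1 else 0)
    (block i) (position i))); last first.
  by move=> i _; rewrite !mxE; case: ifP => _; rewrite ?mul0r.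
rewrite (sum_coordinates (fun g' j => if g' == g then link e j * h ^+ j.+1 else 0)).
rewrite (bigD1 g) //= eqxx [X in _ + X]big1 => [|g' /negPf ->]; last by rewrite big1.
rewrite addr0 /link; under eq_bigr do rewrite mulrBl -mulrA.
rewrite sumrB -mulr_sumr; congr (_ * _ - _).
  case: e eb => [|e] eb; first by rewrite big1 // => j _; rewrite mul0r.
  rewrite (bigD1 (Ordinal eb)) //= eqxx mul1r big1 ?addr0 // => j je.
  by rewrite eqSS (_ : (j == e :> nat) = false) ?mul0r //; exact: negPf je.
case: (ltngtP e b) eb => // [eb|->] _; last first.
  by rewrite big1 // => j _; rewrite ltn_eqF ?mul0r.
rewrite (bigD1 (Ordinal eb)) //= eqxx mul1r big1 ?addr0 // => j je.
by rewrite (_ : (j == e :> nat) = false) ?mul0r //; exact: negPf je.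
Qed.

(** Only links x and x + 1 act on position x, so stationarity there reduces to mu n h = a (1 - h)^2,
    which is [rate_quadratic]. The two ends are adjusted to the same equation. *)
Lemma total_min : total_mx *m hard_min = total_vec.
Proof.
rewrite total_mxM total_vecE -[RHS]scalerA; congr (_ *: _); apply/colP => i.
have ib := position_lt i; set x := position i in ib *.
pose D e := (if e == b then Num.sqrt (1 - h) else 1) * (if e == 0%N then 0 else h ^+ e)
  - (if e == b then 0 else h ^+ e.+1).
have -> : \sum_(g < n) \sum_(e < b.+1) dot (link_vec g e) hard_min *: link_vec g e
    = \sum_(e < b.+1) D e *: \sum_(g < n) link_vec g e.
  rewrite exchange_big /=; apply: eq_bigr => e _; rewrite scaler_sumr.
  by apply: eq_bigr => g _; rewrite dot_link_min // -ltnS.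
have sum_link_vecE e : (\sum_(g < n) link_vec g e) i 0 = link e x.
  rewrite summxE (bigD1 (block i)) //= big1 ?addr0 ?mxE ?eqxx // => g gi.
  by rewrite mxE eq_sym (negPf gi).
rewrite mxE [X in X + _]mxE [X in _ + X]mxE [RHS]mxE sum_link_vecE mxE -/x summxE.
under eq_bigr do rewrite mxE sum_link_vecE.
(* At the last position the square of sqrt (1 - h) restores the value of an interior link. *)
have s1 : (if x.+1 == b then Num.sqrt (1 - h) else 1) * D x.+1 = h ^+ x.+1 * (1 - h).
  rewrite /D; case: ifP => _; last by rewrite /= [h ^+ x.+2]exprS; ring.
  by rewrite subr0 /= mulrA -expr2 sqr_sqrtr ?subr_ge0 ?(ltW h_lt1) // mulrC.
have -> : \sum_(e < b.+1) D e * link e x = h ^+ x.+1 * (1 - h) - D x.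
  rewrite -s1; under eq_bigr do rewrite mulrBr.
  rewrite sumrB; congr (_ - _).
    have xb : (x.+1 < b.+1)%N by [].
    rewrite (bigD1 (Ordinal xb)) //= eqxx mulr1 big1 ?addr0 ?(mulrC (D _)) // => e ne.
    by rewrite (_ : (x.+1 == e :> nat) = false) ?mulr0 // eq_sym; exact: negPf ne.
  have xb : (x < b.+1)%N by rewrite ltnW.
  rewrite (bigD1 (Ordinal xb)) //= eqxx mulr1 big1 ?addr0 // => e ne.
  by rewrite (_ : (x == e :> nat) = false) ?mulr0 // eq_sym; exact: negPf ne.
(* At x = 0 the interior formula exceeds D 0 = - h by 1; the linear term compensates. *)
have -> : D x = h ^+ x * (1 - h) - (x == 0%N)%:R.
  rewrite /D ltn_eqF //; case: (x) => [|y] /=; first by rewrite expr0 expr1; ring.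
  by rewrite !exprS; ring.
have -> : link 0 x = - (x == 0%N)%:R by rewrite /link mulr0 sub0r.
have hq : mu * n%:R * h = a * (1 - h) ^+ 2.
  have q := rate_quadratic kappa_ge k_gt0; rewrite -/h in q.
  have -> : a = mu * n%:R * (L / mu / n%:R - 1) / (4 * k%:R).
    by rewrite /a; field; rewrite !pnatr_eq0 -!lt0n k_gt0 n_gt0 gt_eqF.
  have -> : mu * n%:R * (L / mu / n%:R - 1) / (4 * k%:R) * (1 - h) ^+ 2
    = mu * n%:R / (4 * k%:R) * ((1 - h) ^+ 2 * (L / mu / n%:R - 1)) by ring.
  by rewrite q; field; rewrite pnatr_eq0 -lt0n.
rewrite exprS mulrA hq; ring.
Qed.

Lemma trmx_total_mx : total_mx^T = total_mx.
Proof.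
by rewrite /total_mx raddf_sum; apply: eq_bigr => i _; rewrite /= trmx_hard_mx.
Qed.

Lemma total_mx_ge x : (m * n)%:R * mu * dot x x <= dot x (total_mx *m x).
Proof.
rewrite total_mxM dotZr dotDr !dotZr dot_sumr mulrDr natrM.
rewrite [leLHS](_ : _ = m%:R * (mu * n%:R * dot x x)); last by ring.
rewrite lerDl mulr_ge0 // mulr_ge0 //.
  by rewrite divr_ge0 ?mulr_ge0 ?subr_ge0.
apply: sumr_ge0 => g _; rewrite dot_sumr; apply: sumr_ge0 => e _.
by rewrite dotZr dotC -expr2 sqr_ge0.
Qed.

Let N : R := (m * n)%:R.
Let N_gt0 : 0 < N. Proof. by rewrite ltr0n muln_gt0 m_gt0. Qed.

Lemma average_hard x : average hard_fun x = quad (N^-1 *: total_mx) (N^-1 *: total_vec) x.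
Proof.
rewrite /average /hard_fun -quad_scale; congr (_ * _).
exact: (sum_quad predT (fun i => hard_mx (dec i).1 (dec i).2)
  (fun i => hard_vec (dec i).1 (dec i).2)).
Qed.

Lemma average_mx_ge x : mu * dot x x <= dot x (N^-1 *: total_mx *m x).
Proof.
rewrite -scalemxAl dotZr [leRHS]mulrC ler_pdivlMr // [leLHS]mulrC mulrA.
exact: total_mx_ge.
Qed.

Lemma average_mx_sym : (N^-1 *: total_mx)^T = N^-1 *: total_mx.
Proof. by rewrite linearZ /= trmx_total_mx. Qed.

Lemma hard_admissible : admissible L mu hard_fun.
Proof.
split=> [i|i|].
- by apply: convex_quad => [|x]; [exact: trmx_hard_mx | exact: hard_psd].
- apply: smooth_quad; [|exact: trmx_hard_mx|exact: hard_row_sum].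
  by apply: le_trans mun; rewrite mulr_ge0 // ltW.
have -> : average hard_fun = quad (N^-1 *: total_mx) (N^-1 *: total_vec).
  by apply/funext => x; exact: average_hard.
by apply: strongly_convex_quad; [exact: ltW|exact: average_mx_sym|exact: average_mx_ge].
Qed.

Lemma hard_gap x :
  mu / 2 * dot (x - hard_min) (x - hard_min) <=
  average hard_fun x - average hard_fun hard_min.
Proof.
rewrite !average_hard quad_gap; first last.
- by rewrite -scalemxAl total_min.
- exact: average_mx_sym.
by rewrite [leLHS]mulrAC [leLHS]mulrC ler_wpM2l ?invr_ge0 // average_mx_ge.
Qed.

Lemma hard_minimizer : minimizer (average hard_fun) hard_min.
Proof.
move=> x; rewrite -subr_ge0; apply: le_trans (hard_gap x).
by rewrite mulr_ge0 ?dot_ge0 // divr_ge0 // ltW.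
Qed.

Lemma enorm_hard_min :
  enorm hard_min ^+ 2 = n%:R * \sum_(j < b) h ^+ (2 * j.+1).
Proof.
rewrite enormK /dot (eq_bigr (fun i => (fun _ j => h ^+ (2 * j.+1)) (block i) (position i))).
  by rewrite (sum_coordinates (fun _ j => h ^+ (2 * j.+1))) sumr_const card_ord mulr_natl.
by move=> i _; rewrite !mxE -expr2 -exprM mulnC.
Qed.

Section Cut.
Variables (r : nat) (al : allocation m n r) (g : 'I_n).
Hypothesis missing : forall j, exists2 s, (s < k)%N &
  forall i, i \in acquired al j -> (dec i).2 = g -> ((dec i).1 %% k != s)%N.

(** Position 0 outside block g lets every cut t > 0 keep the other blocks whole, so their functions
    commute with the truncation. *)
Let pos i := if block i == g then position i else 0%N.

(** A window of k consecutive indices meets the missing class once, at t, and link t alone crosses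
    the cut t. The linear term survives since it lives at position 0 < t. *)
Lemma exists_cut j u : exists t, [/\ (u < t <= u + k)%N,
  forall i, i \in acquired al j ->
    hard_mx (dec i).1 (dec i).2 *m trunc pos t =
    trunc pos t *m hard_mx (dec i).1 (dec i).2 &
  forall i, i \in acquired al j ->
    trunc pos t *m hard_vec (dec i).1 (dec i).2 = hard_vec (dec i).1 (dec i).2].
Proof.
have [s sk smiss] := missing j.
pose t := (u.+1 + (s + (k - u.+1 %% k)) %% k)%N.
have ts : (t %% k = s)%N.
  rewrite /t modnDmr -modnDml addnCA subnKC; last by rewrite ltnW // ltn_pmod.
  by rewrite modnDr modn_small.
have tu : (u < t <= u + k)%N.
  rewrite /t addSn ltnS leq_addr /= -addnS leq_add2l.
  exact: ltn_pmod.
exists t; split=> // i ia.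
  apply: trunc_commute => x y xy; rewrite hard_mxE.
  have -> : (x == y) = false by apply: contraNF xy => /eqP ->.
  rewrite mulr0 add0r big1 ?mulr0 // => e /eqP eq_e; rewrite !mxE.
  have [bx|] := eqVneq (block x); last by rewrite mul0r.
  have [by_|] := eqVneq (block y); last by rewrite mulr0.
  have [ig|nig] := eqVneq (dec i).2 g; last first.
    by move: xy; rewrite /pos bx by_ (negPf nig) eqxx.
  move: xy; rewrite /pos bx by_ ig eqxx => xy.
  have := smiss i ia ig; rewrite -eq_e -ts => et.
  have {}et : e != t :> nat by apply: contraNneq et => ->.
  apply/eqP; rewrite mulf_eq0; apply: contraT; rewrite negb_or.
  by move=> /andP[/link_neq0 ex /link_neq0 ey]; rewrite (crossing_link ex ey xy) eqxx in et.
apply/trunc_fixedP => x tx; rewrite mxE mxE.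
have [bx|] := eqVneq (block x); last by rewrite mulr0.
have x0 : position x != 0%N.
  apply: contraTneq tx => x0; rewrite /pos x0 if_same -ltnNge.
  by case/andP: tu => /(leq_ltn_trans (leq0n u)).
by rewrite /link (negPf x0) subr0 mulr0 mulr0.
Qed.

Lemma hard_output_supported H x :
  possible_output hard_fun al H x ->
  forall i, block i = g -> (H * k <= position i)%N -> x i 0 = 0.
Proof.
move=> xH i ig Hi.
apply: (output_supported (pos := pos) (k := k) _ exists_cut xH).
  by move=> l; exact: trmx_hard_mx.
by rewrite /pos ig eqxx.
Qed.

End Cut.

End HardInstance.

(** * Expected gap *)

Lemma measurable_quad (R : realType) (disp : measure_display) (T : measurableType disp)
    (d : nat) (A : 'M[R]_d) (c : 'cV[R]_d) (x : T -> 'cV[R]_d) :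
  (forall i, measurable_fun setT (fun s => x s i 0 : R)) ->
  measurable_fun setT (fun s => quad A c (x s)).
Proof.
move=> mx; rewrite /quad /dot; apply: measurable_funB.
  apply: measurable_funM; first exact: measurable_cst.
  apply: measurable_sum => i; apply: measurable_funM; first exact: mx.
  under eq_fun do rewrite mxE.
  by apply: measurable_sum => j; apply: measurable_funM; [exact: measurable_cst | exact: mx].
by apply: measurable_sum => j; apply: measurable_funM; [exact: measurable_cst | exact: mx].
Qed.

Lemma expected_gap_ge (R : realType) (m n r d : nat) (A : algorithm R m n r)
    (f : 'I_(m * n) -> 'cV[R]_d -> R) (H : nat) (xs : 'cV[R]_d)
    (gap : allocation m n r -> R) :
  (forall a, measurable_fun setT (fun s => average f (alg_output A f H a s))) ->
  (forall a, 0 <= gap a) ->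
  (forall a x, a \in even_allocations m n r -> possible_output f a H x ->
     gap a <= average f x - average f xs) ->
  (((#|even_allocations m n r|%:R)^-1 * \sum_(a in even_allocations m n r) gap a)%:E
    <= expected_gap A f H xs)%E.
Proof.
move=> mf gap0 gap_le; rewrite /expected_gap EFinM lee_wpmul2l ?lee_fin ?invr_ge0 //.
rewrite -sumEFin; apply: lee_sum => a aE.
rewrite -(expectation_cst (alg_prob A) (gap a)); apply: expectation_le => //.
- by apply: measurable_funB; [exact: mf | exact: measurable_cst].
- by move=> s; exact: gap0.
- by move=> s; apply: le_trans (gap0 a) _; apply: gap_le => //; exact: alg_possible.
- by apply: aeW => s; apply: gap_le => //; exact: alg_possible.
Qed.

(** Pigeonhole: fewer than k functions cannot meet all k classes. *)
Lemma missing_class (m n k : nat) (dec : 'I_(m * n) -> 'I_m * 'I_n) (g : 'I_n)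
    (S : {set 'I_(m * n)}) : (0 < k)%N ->
  (#|(S :&: [set i | (dec i).2 == g]%SET)%SET| < k)%N ->
  exists2 s, (s < k)%N & forall i, i \in S -> (dec i).2 = g -> ((dec i).1 %% k != s)%N.
Proof.
move=> k_gt0; set G := (_ :&: _)%SET => Gk.
pose cl i := Ordinal (ltn_pmod (dec i).1 k_gt0).
have : ~~ ([set: 'I_k]%SET \subset [set cl i | i in G]%SET).
  apply/negP => /subset_leq_card; rewrite cardsT card_ord leqNgt.
  by rewrite (leq_ltn_trans (leq_imset_card _ _)).
move=> /subsetPn[s _ sG]; exists s => // i iS ig; apply: contraNneq sG => is_.
apply/imsetP; exists i; first by rewrite !inE iS ig eqxx.
exact: val_inj.
Qed.

(** The tail is h^(2 l) times the sum of the first b - l terms. These make up at least half of the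
    whole, because the last l terms are h^(2 (b - l)) times the first l. *)
Lemma geometric_tail (R : realType) (h : R) (b l : nat) :
  0 <= h -> (l <= b)%N -> h ^+ (2 * (b - l)) <= 2^-1 ->
  h ^+ (2 * l) * \sum_(j < b) h ^+ (2 * j.+1) <=
  2 * \sum_(j < b | (l <= j)%N) h ^+ (2 * j.+1).
Proof.
move=> h0 lb hb; set W := \sum_(j < b) _; set T := \sum_(_ < _ | _) _.
have T0 : 0 <= T by apply: sumr_ge0 => j _; exact: exprn_ge0.
have Tl : T = h ^+ (2 * l) * \sum_(j < b - l) h ^+ (2 * j.+1).
  rewrite /T mulr_sumr (eq_bigl (fun j : 'I_b => predT (j : nat) && (l <= j)%N)) //.
  rewrite -(big_geq_mkord _ _ predT (fun j => h ^+ (2 * j.+1))) -{1}[l]add0n.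
  rewrite big_addn big_mkord; apply: eq_bigr => j _.
  by rewrite -exprD; congr (_ ^+ _); lia.
have split p q : \sum_(j < p + q) h ^+ (2 * j.+1) = \sum_(j < p) h ^+ (2 * j.+1) +
    h ^+ (2 * p) * \sum_(j < q) h ^+ (2 * j.+1).
  rewrite big_split_ord /= mulr_sumr; congr (_ + _).
  by apply: eq_bigr => j _; rewrite -exprD; congr (_ ^+ _); lia.
have Wl := split (b - l)%N l; rewrite subnK // -/W in Wl.
have lW : \sum_(j < l) h ^+ (2 * j.+1) <= W.
  have := split l (b - l)%N; rewrite subnKC // -/W => ->.
  by rewrite lerDl mulr_ge0 ?exprn_ge0 ?sumr_ge0 // => j _; exact: exprn_ge0.
have W0 : 0 <= W by apply: sumr_ge0 => j _; exact: exprn_ge0.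
have W2 : W <= 2 * \sum_(j < b - l) h ^+ (2 * j.+1).
  have : h ^+ (2 * (b - l)) * \sum_(j < l) h ^+ (2 * j.+1) <= 2^-1 * W.
    by apply: ler_pM => //; [exact: exprn_ge0 | apply: sumr_ge0 => j _; exact: exprn_ge0].
  by rewrite {2}Wl; lra.
by rewrite Tl mulrCA ler_wpM2l // exprn_ge0.
Qed.

Section ExpectedGap.
Context {R : realType}.
Variables (m n k b : nat) (L mu : R).
Variable dec : 'I_(m * n) -> 'I_m * 'I_n.
Hypothesis dec_bij : bijective dec.
Hypotheses (m_gt0 : (0 < m)%N) (n_gt0 : (0 < n)%N) (k_gt1 : (1 < k)%N).
Hypotheses (k_le_m : (k <= m)%N) (b_gt0 : (0 < b)%N) (mu_gt0 : 0 < mu).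
Hypothesis kappa_ge : 1 <= L / mu / n%:R.
Variables (r : nat) (A : algorithm R m n r).

Let h := rate (L / mu / n%:R) k.
Let h_ge0 : 0 <= h. Proof. exact: rate_ge0. Qed.
Let k_gt0 : (0 < k)%N. Proof. exact: ltnW. Qed.
Let E := even_allocations m n r.

Let F : 'I_(m * n) -> 'cV[R]_#|{: 'I_n * 'I_b}| -> R := hard_fun k L mu dec.
Let xs : 'cV[R]_#|{: 'I_n * 'I_b}| := hard_min n k b L mu.

Let members (g : 'I_n) : {set 'I_(m * n)} := [set i | (dec i).2 == g]%SET.

Let card_members g : #|members g| = m.
Proof.
have [f fK Kf] := dec_bij.
have -> : members g = [set f (q, g) | q in 'I_m]%SET.
  apply/setP => i; rewrite inE; apply/eqP/imsetP => [ig|[q _ ->]]; last by rewrite Kf.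
  by exists (dec i).1 => //; rewrite -ig -surjective_pairing fK.
by rewrite card_imset ?card_ord // => q q' /(can_inj Kf) [].
Qed.

Let good (a : allocation m n r) (g : 'I_n) : bool :=
  [forall j, #|(acquired a j :&: members g)%SET| < k]%N.

Let tail (H : nat) : R := \sum_(j < b | (H * k <= j)%N) h ^+ (2 * j.+1).

Let tail_ge0 H : 0 <= tail H.
Proof. by apply: sumr_ge0 => j _; exact: exprn_ge0. Qed.

Let even_gt0 : (0 < #|E|)%N.
Proof.
have [f fK Kf] := dec_bij.
have N_gt0 : (0 < m * n)%N by rewrite muln_gt0 m_gt0.
apply/card_gt0P; exists ([ffun i => (dec i).1], [ffun=> [ffun=> Ordinal N_gt0]]).
rewrite /E even_allocationsE !inE andbT; apply/forallP => j.
have -> : [set i | [ffun i => (dec i).1] i == j]%SET = [set f (j, g) | g in 'I_n]%SET.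
  apply/setP => i; rewrite inE ffunE; apply/eqP/imsetP => [ij|[g _ ->]]; last by rewrite Kf.
  by exists (dec i).2 => //; rewrite -ij -surjective_pairing fK.
by rewrite card_imset ?card_ord // => g g' /(can_inj Kf) [].
Qed.

Lemma output_gap (a : allocation m n r) H x :
  possible_output F a H x ->
  mu / 2 * (\sum_(g | good a g) tail H) <=
  average F x -
  average F xs.
Proof.
move=> xH; apply: le_trans (hard_gap dec_bij m_gt0 n_gt0 k_gt1 k_le_m b_gt0 mu_gt0 kappa_ge x).
rewrite ler_wpM2l ?divr_ge0 ?(ltW mu_gt0) //.
set z := x - _.
pose c g (j : nat) := if good a g && (H * k <= j)%N then h ^+ (2 * j.+1) else 0.
have -> : \sum_(g | good a g) tail H =
    \sum_(i < #|{: 'I_n * 'I_b}|) c (block i) (position i).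
  rewrite (sum_coordinates b c) /c big_mkcond; apply: eq_bigr => g _.
  case: ifP => _; first by rewrite /tail big_mkcond.
  by rewrite big1.
apply: ler_sum => i _; rewrite /c; case: ifP => [/andP[gi Hi]|_]; last first.
  by rewrite -expr2 sqr_ge0.
rewrite !mxE (hard_output_supported k_gt1 _ xH (erefl _) Hi).
  by rewrite sub0r mulrNN -expr2 -exprM mulnC.
move=> j; apply: missing_class => //.
by move/forallP: gi; apply.
Qed.

Lemma good_card_ge (delta : R) (g : 'I_n) :
  m%:R * expR ((expR 1 - 1) * (1 + r%:R / n%:R) - k%:R) <= delta ->
  (1 - delta) * #|E|%:R <= #|[set a in E | good a g]%SET|%:R.
Proof.
move=> hd.
have := @overload_card R m n r n_gt0 k (members g) (card_members g).
set B := [set a in _ | _]%SET => hB.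
have split (X : {set allocation m n r}) (P : pred (allocation m n r)) :
    #|X| = (#|[set a in X | P a]%SET| + #|[set a in X | ~~ P a]%SET|)%N.
  rewrite -[LHS](cardsID [set a | P a]%SET); congr (_ + _)%N; apply: eq_card => a.
    by rewrite !inE.
  by rewrite !inE andbC.
have := split E (fun a => [exists j, k <= #|(acquired a j :&: members g)%SET|]%N).
rewrite -/B (_ : [set a in E | ~~ _]%SET = [set a in E | good a g]%SET); last first.
  apply/setP => a; rewrite !inE negb_exists; congr (_ && _).
  by apply: eq_forallb => j; rewrite -ltnNge.
move=> cE.
have {}hB := le_trans hB (ler_wpM2r (ler0n R _) hd).
by move: hB; rewrite -/E cE natrD; lra.
Qed.

(** Exchanging the sums over allocations and blocks: each block is good with probability at least 1
    - delta, whatever the dependence between blocks. *)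
Lemma hard_expected_gap (delta : R) H :
  m%:R * expR ((expR 1 - 1) * (1 + r%:R / n%:R) - k%:R) <= delta ->
  ((mu / 2 * tail H * (n%:R * (1 - delta)))%:E <=
   expected_gap A F H xs)%E.
Proof.
move=> hd.
apply: le_trans; last first.
  apply: (@expected_gap_ge _ _ _ _ _ _ _ _ _ (fun a => mu / 2 * (\sum_(g | good a g) tail H))).
  - move=> a; under eq_fun do rewrite average_hard.
    by apply: measurable_quad => i; exact: alg_measurable.
  - move=> a; rewrite mulr_ge0 ?divr_ge0 ?(ltW mu_gt0) // sumr_ge0 // => g _; exact: tail_ge0.
  - by move=> a x _; exact: output_gap.
rewrite lee_fin ler_pdivlMl ?ltr0n // -mulr_sumr.
have -> : \sum_(a in E) \sum_(g | good a g) tail H =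
    \sum_(g < n) #|[set a in E | good a g]%SET|%:R * tail H.
  rewrite (exchange_big_dep predT) //=; apply: eq_bigr => g _.
  by rewrite sumr_const mulr_natl; congr (_ *+ _); apply: eq_card => a; rewrite inE.
have : \sum_(g < n) (1 - delta) * #|E|%:R <= \sum_(g < n) #|[set a in E | good a g]%SET|%:R.
  by apply: ler_sum => g _; exact: good_card_ge.
rewrite sumr_const card_ord -[_ *+ n]mulr_natl -mulr_suml => hsum.
have c0 : 0 <= mu / 2 * tail H by rewrite mulr_ge0 ?divr_ge0 ?(ltW mu_gt0).
apply: le_trans (_ : _ <= (mu / 2 * tail H) * (n%:R * ((1 - delta) * #|E|%:R))) _.
  by rewrite le_eqVlt; apply/orP; left; apply/eqP; ring.
by apply: le_trans (ler_wpM2l c0 hsum) _; rewrite mulrAC mulrA.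
Qed.

End ExpectedGap.

(** * The lower bound *)

Lemma index_bij (m n : nat) : exists dec : 'I_(m * n) -> 'I_m * 'I_n, bijective dec.
Proof.
have cE : (m * n = #|{: 'I_m * 'I_n}|)%N by rewrite card_prod !card_ord.
exists (enum_val \o cast_ord cE); apply: bij_comp; first exact: enum_val_bij.
by exists (cast_ord (esym cE)); [exact: cast_ordK | exact: cast_ordKV].
Qed.

Lemma powR_3_2 (R : realType) (x : R) : 0 <= x -> x `^ (3 / 2) = Num.sqrt (x ^+ 3).
Proof. by move=> x0; rewrite powRrM powR_mulrn // powR12_sqrt // exprn_ge0. Qed.

Lemma ln_le_id (R : realType) (x : R) : 0 <= x -> ln x <= x.
Proof.
rewrite le_eqVlt => /predU1P[<-|x0]; first by rewrite ln0.
by rewrite -ler_expR lnK // (le_trans _ (expR_ge1Dx x)) // lerDr.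
Qed.

(** A crude bound, whose point is that it does not depend on b. *)
Lemma sum_geometric_le (R : realType) (h : R) b : 0 <= h -> h < 1 ->
  \sum_(j < b) h ^+ (2 * j.+1) <= (1 - h)^-1.
Proof.
move=> h0 h1; apply: (@le_trans _ _ (\sum_(j < b) h ^+ j)).
  by apply: ler_sum => j _; apply: ler_wiXn2l => //; [exact: ltW | lia].
rewrite -[leRHS]mul1r ler_pdivlMr ?subr_gt0 //.
have := subrX1 h b; have := exprn_ge0 b h0; lra.
Qed.

Section LowerBound.
Context {R : realType}.
Variables (alpha : R) (m n : nat) (L mu : R).
Variable A : algorithm R m n (ceiln (alpha * n%:R)).
Let e : R := expR 1.
Let M : R := Num.max 1 alpha.
Hypotheses (alpha_ge0 : 0 <= alpha) (m_gt0 : (0 < m)%N) (mn : (m < n)%N).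
Hypotheses (mu_gt0 : 0 < mu) (kappa_ge : n%:R <= L / mu).
Hypothesis m_large :
  Num.max (expR (alpha / M * expR (2 / M + 1))) ((e + M) ^+ 2) <= m%:R.

Let n_gt0 : (0 < n)%N. Proof. exact: ltn_trans mn. Qed.
Let k := kval alpha m.
Let kp : R := L / mu / n%:R.
Let h := rate kp k.
Let delta : R := 1 / ((e + expR alpha) * (e + M) ^+ 2).
Let kr : R := (e + M) * ln m%:R.

Let kp1 : 1 <= kp.
Proof. by rewrite ler_pdivlMr ?mul1r // ltr0n. Qed.
Let k_gt1 : (1 < k)%N. Proof. exact: kval_gt1 m_large. Qed.
Let k_gt0 : (0 < k)%N. Proof. exact: ltnW. Qed.
Let k_le : (k <= m)%N. Proof. exact: kval_le m_large. Qed.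
Let kr6 : 6 <= kr. Proof. exact: kval_real_ge m_large. Qed.
Let kr0 : 0 <= kr. Proof. exact: le_trans kr6. Qed.
Let h_ge0 : 0 <= h. Proof. exact: rate_ge0. Qed.
Let h_lt1 : h < 1. Proof. exact: rate_lt1. Qed.

Lemma delta_le_half : delta <= 1 / 2.
Proof.
have e2 : 5 / 2 <= e by exact: expR1_ge.
have M1 : 1 <= M by rewrite /M le_max lexx.
have a0 := expR_gt0 alpha.
have : 2 <= (e + expR alpha) * (e + M) ^+ 2.
  have : 1 <= (e + M) ^+ 2 by rewrite exprn_ege1 //; lra.
  nra.
move=> h2; rewrite /delta !mul1r lef_pV2 ?posrE //; lra.
Qed.

Lemma enorm_wstar u :
  enorm (wstar alpha (L / mu) m n u) ^+ 2 = \sum_(j < u * k) h ^+ (2 * j.+1).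
Proof.
rewrite enormK; apply: eq_bigr => j _; rewrite !mxE -expr2 -exprM mulnC.
by [].
Qed.

Let prefactor : R := Num.sqrt (kp - 1) / (4 * Num.sqrt 2 * kr `^ (3 / 2)).

Let kr_pos : 0 < 4 * Num.sqrt 2 * kr `^ (3 / 2).
Proof. by rewrite !mulr_gt0 ?sqrtr_gt0 ?powR_gt0 ?(lt_le_trans _ kr6). Qed.

(** [u0] is chosen before H, whereas the tail estimate wants u large compared to H. The argument is
    by contradiction: an H that violates the bound is itself bounded independently of u. *)
Lemma communication_lower_bound (eps : R) : 0 < eps ->
  exists u0 : nat, forall u : nat, (u0 <= u)%N ->
  forall (H : nat) (dec : 'I_(m * n) -> 'I_m * 'I_n), bijective dec ->
  let W := \sum_(j < u * k) h ^+ (2 * j.+1) in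
  (expected_gap A (@hard_fun R m n k (u * k) L mu dec) H (hard_min n k (u * k) L mu)
     <= eps%:E)%E ->
  prefactor * ln ((1 - delta) * (mu * n%:R * W / (4 * eps))) <= H%:R.
Proof.
move=> eps0; pose c := (1 - delta) * (mu * n%:R / (4 * eps)).
have c0 : 0 <= c.
  rewrite mulr_ge0 ?divr_ge0 ?mulr_ge0 ?(ltW mu_gt0) ?(ltW eps0) //.
  by have := delta_le_half; lra.
have p0 : 0 <= prefactor by rewrite divr_ge0 ?sqrtr_ge0 // ltW.
have [j1 hj1] := geometric_half h_ge0 h_lt1.
(* The ceiling bounds a violating H through ln (c W) <= c W <= c / (1 - h); the extra [j1] forces
   h^(2 (u k - H k)) <= 1/2. *)
exists (ceiln (prefactor * (c / (1 - h))) + j1).+1 => u uu0 H dec dec_bij W gapH.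
have -> : (1 - delta) * (mu * n%:R * W / (4 * eps)) = c * W.
  by rewrite /c; field; rewrite gt_eqF.
have W0 : 0 <= W by apply: sumr_ge0 => j _; exact: exprn_ge0.
rewrite leNgt; apply/negP => Hlt.
have B0 : 0 <= prefactor * (c / (1 - h)).
  by rewrite mulr_ge0 // divr_ge0 // subr_ge0 ltW.
have HB : (H < ceiln (prefactor * (c / (1 - h))))%N.
  rewrite -(ltr_nat R); apply: lt_le_trans (ceiln_ge B0).
  apply: lt_le_trans Hlt _; rewrite ler_wpM2l //.
  apply: le_trans (ln_le_id _) _; first by rewrite mulr_ge0.
  by rewrite ler_wpM2l // sum_geometric_le.
have Hj : (H + j1 <= u)%N by rewrite (leq_trans _ uu0) // leqW // leq_add2r ltnW.
have Hu : (H * k <= u * k)%N by rewrite leq_mul2r (leq_trans (leq_addr _ _) Hj) orbT.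
have hb : h ^+ (2 * (u * k - H * k)) <= 2^-1.
  apply: le_trans hj1; apply: ler_wiXn2l => //; first exact: ltW.
  rewrite -mulnBl mulnCA (leq_trans (n := u - H)) //.
    by rewrite leq_subRL // (leq_trans (leq_addr _ _) Hj).
  by rewrite leq_pmulr // muln_gt0.
have := geometric_tail h_ge0 Hu hb; rewrite -/W; set T := \sum_(_ < _ | _) _ => tail_ge.
have b_gt0 : (0 < u * k)%N by rewrite muln_gt0 k_gt0 andbT (leq_trans _ uu0).
have := le_trans (@hard_expected_gap R m n k (u * k) L mu dec dec_bij m_gt0 n_gt0
   k_gt1 k_le b_gt0 mu_gt0 kp1 _ A delta H (overload_prob_le alpha_ge0 m_gt0 mn m_large)) gapH.
rewrite lee_fin -/h -/T => gap_le.
have XH : c * W * h ^+ (2 * (k * H)) <= 1.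
  rewrite (mulnC k) -mulrA [W * _]mulrC.
  apply: le_trans (ler_wpM2l c0 tail_ge) _.
  rewrite (_ : c * _ = (mu / 2 * T * (n%:R * (1 - delta))) / eps).
    by rewrite ler_pdivrMr // mul1r.
  by rewrite /c; field; rewrite gt_eqF.
have := rate_communication_bound kp1 k_gt0 (mulr_ge0 c0 W0) XH => lnX.
have kk : k%:R * Num.sqrt (k%:R : R) <= Num.sqrt 2 * kr `^ (3 / 2).
  rewrite powR_3_2 // -sqrtrM // -{1}[k%:R]ger0_norm // -sqrtr_sqr -sqrtrM ?sqr_ge0 //.
  by rewrite ler_wsqrtr // -exprSr; exact: kval_cube_le m_large.
move: Hlt; rewrite /prefactor mulrAC ltr_pdivlMr // => /lt_le_trans/(_ lnX).
rewrite ltNge => /negP; apply.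
rewrite (_ : H%:R * _ = 4 * (Num.sqrt 2 * kr `^ (3 / 2)) * H%:R); last by ring.
by rewrite ler_wpM2r // ler_wpM2l.
Qed.

End LowerBound.

Theorem theorem3 (R : realType) (alpha : R) (halpha : 0 <= alpha) :
  let e : R := expR 1 in
  let M : R := Num.max 1 alpha in
  exists C K0 X0 : R, 0 < C /\
  forall (m n : nat) (L mu : R)
         (A : algorithm R m n (ceiln (alpha * n%:R))),
    (0 < m)%N -> (m < n)%N ->
    0 < mu ->
    n%:R <= L / mu ->
    reaches_every_accuracy L mu A ->
    Num.max (expR (alpha / M * expR (2 / M + 1))) ((e + M) ^+ 2) <= m%:R ->
    forall eps : R, 0 < eps ->
    exists u0 : nat, forall u : nat, (u0 <= u)%N ->
    let kappa := L / mu in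
    let w := wstar alpha kappa m n u in
    let bound :=
      Num.sqrt (kappa / n%:R - 1)
        / (4 * Num.sqrt 2 * ((e + M) * ln m%:R) `^ (3 / 2))
      * ln ((1 - 1 / ((e + expR alpha) * (e + M) ^+ 2))
            * (mu * n%:R * enorm w ^+ 2 / (4 * eps))) in
    (exists (d : nat) (f : 'I_(m * n) -> 'cV[R]_d -> R) (xstar : 'cV[R]_d),
      [/\ admissible L mu f,
          minimizer (average f) xstar,
          enorm xstar ^+ 2 = n%:R * enorm w ^+ 2
        & forall H_eps : nat,
            (expected_gap A f H_eps xstar <= eps%:E)%E ->
            bound <= H_eps%:R])
    /\ (K0 <= kappa / n%:R -> X0 <= mu * n%:R * enorm w ^+ 2 / eps ->
        C * (Num.sqrt (kappa / (n%:R * ln m%:R ^+ 3))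
             * ln (mu * n%:R * enorm w ^+ 2 / eps))
        <= bound).
Proof.
move=> e M.
(* kappa / n >= 2 gives sqrt (kappa / n - 1) >= sqrt (kappa / n) / sqrt 2; X >= 64 gives X / 8 >=
   sqrt X, so the logarithm loses a factor 2. Hence 16 = 4 sqrt 2 sqrt 2 2. *)
exists ((16 * (e + M) `^ (3 / 2))^-1), 2, 64.
have eM0 : 0 < e + M by rewrite ltr_pwDl ?expR_gt0 // le_max ler01.
split; first by rewrite invr_gt0 mulr_gt0 // powR_gt0.
move=> m n L mu A m_gt0 mn mu_gt0 kappa_ge _ m_large eps eps_gt0.
have n_gt0 : (0 < n)%N by exact: ltn_trans mn.
have kp1 : 1 <= L / mu / n%:R by rewrite ler_pdivlMr ?mul1r // ltr0n.
have k_gt1 := kval_gt1 m_gt0 m_large; have k_le := kval_le m_gt0 m_large.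
have [u0 hu0] := communication_lower_bound A halpha m_gt0 mn mu_gt0 kappa_ge m_large eps_gt0.
(* The successor makes u positive, so that the chain is not empty. *)
exists u0.+1 => u uu0; set kappa := L / mu; cbv zeta; rewrite enorm_wstar.
set W := \sum_(j < _) _; split.
  have [dec dec_bij] := index_bij m n.
  have b_gt0 : (0 < u * kval alpha m)%N by rewrite muln_gt0 (leq_trans _ uu0) // ltnW.
  exists #|{: 'I_n * 'I_(u * kval alpha m)}|, (hard_fun (kval alpha m) L mu dec),
    (hard_min n (kval alpha m) _ L mu).
  split; [exact: hard_admissible|exact: hard_minimizer|by rewrite enorm_hard_min|].
  by move=> H; exact: (hu0 u (ltnW uu0) H dec dec_bij).
move=> K2 X64.
set kp := kappa / n%:R in K2 *; set X := mu * n%:R * W / eps in X64 *.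
pose l : R := ln m%:R; pose q : R := (e + M) `^ (3 / 2).
have l0 : 0 < l.
  have : 0 < (e + M) * l by apply: lt_le_trans (kval_real_ge m_gt0 m_large).
  by rewrite pmulr_rgt0.
have q0 : 0 < q by rewrite powR_gt0.
pose s := Num.sqrt (l ^+ 3); have s0 : 0 < s by rewrite sqrtr_gt0 exprn_gt0.
have -> : ((e + M) * l) `^ (3 / 2) = q * s.
  by rewrite powRM ?(ltW eM0) ?(ltW l0) // [l `^ _]powR_3_2 // ltW.
have -> : kappa / (n%:R * l ^+ 3) = kp / l ^+ 3.
  by rewrite /kp; field; rewrite pnatr_eq0 -lt0n n_gt0 gt_eqF.
have kp0 : 0 <= kp by lra.
rewrite sqrtrM // sqrtrV ?exprn_ge0 ?(ltW l0) // -/s.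
have -> : mu * n%:R * W / (4 * eps) = X / 4 by rewrite /X; field; rewrite gt_eqF.
have X0 : 0 < X by lra.
have lnX0 : 0 <= ln X by rewrite ln_ge0 //; lra.
have lnX : ln X / 2 <= ln ((1 - 1 / ((e + expR alpha) * (e + M) ^+ 2)) * (X / 4)).
  have d2 := delta_le_half alpha; set delta := 1 / _ in d2 *.
  have X8_gt0 : 0 < X / 8 by lra.
  have X8 : X / 8 <= (1 - delta) * (X / 4).
    by have : 0 <= (1 / 2 - delta) * X by [rewrite mulr_ge0 ?subr_ge0 // ltW]; lra.
  rewrite ler_pdivrMr //; apply: (@le_trans _ _ (ln (X / 8) * 2)).
    rewrite mulr_natr -(lnXn 2) // ler_ln ?posrE ?exprn_gt0 //.
    have : 0 <= X * (X - 64) by rewrite mulr_ge0 ?subr_ge0 // ltW.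
    by rewrite expr2; lra.
  by rewrite ler_wpM2r // ler_ln ?posrE //; apply: lt_le_trans X8.
have sq : Num.sqrt kp / Num.sqrt 2 <= Num.sqrt (kp - 1).
  by rewrite -sqrtrV // -sqrtrM // ler_wsqrtr //; lra.
have two : Num.sqrt 2 * Num.sqrt 2 = 2 :> R by rewrite -expr2 sqr_sqrtr.
have t0 : 0 < Num.sqrt (2 : R) by rewrite sqrtr_gt0.
apply: (@le_trans _ _ (Num.sqrt kp / Num.sqrt 2 / (4 * Num.sqrt 2 * (q * s)) * (ln X / 2))).
  rewrite le_eqVlt; apply/orP; left; apply/eqP.
  have -> : Num.sqrt kp / Num.sqrt 2 / (4 * Num.sqrt 2 * (q * s)) =
    Num.sqrt kp / (4 * (Num.sqrt 2 * Num.sqrt 2) * (q * s)).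
    by field; rewrite !gt_eqF.
  by rewrite two -/q; field; rewrite !gt_eqF.
apply: ler_pM => //.
- by rewrite !divr_ge0 ?mulr_ge0 ?sqrtr_ge0 // ltW.
- by rewrite divr_ge0.
by rewrite ler_wpM2r // invr_ge0 !mulr_ge0 ?sqrtr_ge0 // ltW.
Qed.
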